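(* Let $G\in\mathcal{F}_{3s}(n)$ be bipartite. Then $\chi''_{(as)}(G)\le \Delta(G)+3$, and $\chi''_{(s)}(G)\le \chi'_s(G)+\varepsilon$, where $\varepsilon=1$ if $\chi'_s(G)>\Delta(G)$ and $\varepsilon=2$ otherwise.
   Context: All graphs are finite, simple and undirected. $\mathcal{F}_{3s}(n)$ denotes the set of simple graphs with $n\ge 3$ vertices, no isolated edges and at most one isolated vertex. $N_e(u)$ is the set of edges incident to $u$. A proper total $k$-coloring of $G$ is a map $f:V(G)\cup E(G)\to\{1,\dots,k\}$ such that adjacent vertices receive distinct colors, edges sharing an end receive distinct colors, and each edge receives a color distinct from the colors of its two ends. $C(f,u)=\{f(e):e\in N_e(u)\}$. $\chi''_{(s)}(G)$ (resp. $\chi''_{(as)}(G)$) is the least $k$ such that $G$ has a proper total $k$-coloring with $C(f,u)\ne C(f,v)$ for all distinct vertices $u,v$ (resp. for the two ends of every edge). $\chi'_s(G)$ is the least number of colors in a proper edge coloring of $G$ in which the sets of colors on edges incident to $u$ and to $v$ differ for all distinct vertices $u,v$. $\Delta(G)$ is the maximum degree. *)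

(* Defs.v *)
From mathcomp Require Import all_boot.

Set Implicit Arguments.
Unset Strict Implicit.
Unset Printing Implicit Defensive.

Record sgraph := SGraph {
  vertex :> finType;
  adj : rel vertex;
  adj_sym : symmetric adj;
  adj_irrefl : irreflexive adj
}.

Definition is_edge (G : sgraph) (E : {set G}) : bool :=
  [exists u : G, exists v : G, adj u v && (E == [set u; v])].

(* Edges are unordered pairs, so that a coloring is a map on V(G) + E(G) only:
   no values are prescribed on non-edges. *)
Definition edge (G : sgraph) : finType := {E : {set G} | is_edge E}.

(* N_e(u) *)
Definition inc (G : sgraph) (u : G) : {set edge G} :=
  [set E : edge G | u \in val E].

Definition deg (G : sgraph) (u : G) : nat := #|[set v : G | adj u v]|.

Definition max_deg (G : sgraph) : nat := \max_(u : G) deg u.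

Definition edges_meet (G : sgraph) (E E' : edge G) : bool :=
  val E :&: val E' != set0.

Definition isolated_vertex (G : sgraph) (u : G) : bool :=
  [forall v : G, ~~ adj u v].

Definition isolated_edge (G : sgraph) (E : edge G) : bool :=
  [forall E' : edge G, (E' != E) ==> ~~ edges_meet E E'].

Definition F3s (n : nat) (G : sgraph) : Prop :=
  [/\ 3 <= n, #|G| = n,
      forall E : edge G, ~~ isolated_edge E
    & #|[set u : G | isolated_vertex u]| <= 1].

Definition bipartite (G : sgraph) : Prop :=
  exists A : {set G}, forall u v : G, adj u v -> (u \in A) != (v \in A).

Section Colorings.
Variables (G : sgraph) (T : finType).

Definition proper_edge_coloring (g : edge G -> T) : bool :=
  [forall E : edge G, forall E' : edge G,
    (E != E') && edges_meet E E' ==> (g E != g E')].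

Definition proper_total_coloring (f : G + edge G -> T) : bool :=
  [&& [forall u : G, forall v : G, adj u v ==> (f (inl u) != f (inl v))],
      proper_edge_coloring (fun E => f (inr E))
    & [forall u : G, forall E in inc u, f (inr E) != f (inl u)]].

(* C(g, u); for a total coloring, g is its restriction to the edges. *)
Definition palette (g : edge G -> T) (u : G) : {set T} := [set g E | E in inc u].

Definition vertex_distinguishing (g : edge G -> T) : bool :=
  [forall u : G, forall v : G, (u != v) ==> (palette g u != palette g v)].

Definition adjacent_distinguishing (g : edge G -> T) : bool :=
  [forall u : G, forall v : G, adj u v ==> (palette g u != palette g v)].

End Colorings.

Definition s_edge_colorable (G : sgraph) (k : nat) : bool :=
  [exists g : {ffun edge G -> 'I_k},
    proper_edge_coloring g && vertex_distinguishing g].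

Definition s_total_colorable (G : sgraph) (k : nat) : bool :=
  [exists f : {ffun G + edge G -> 'I_k},
    proper_total_coloring f && vertex_distinguishing (fun E => f (inr E))].

Definition as_total_colorable (G : sgraph) (k : nat) : bool :=
  [exists f : {ffun G + edge G -> 'I_k},
    proper_total_coloring f && adjacent_distinguishing (fun E => f (inr E))].

Lemma inc_inj n (G : sgraph) (hG : F3s n G) : injective (@inc G).
Proof.
case: hG => _ _ hE hV u v uv; apply/eqP/negPn/negP => neq.
case: (pickP (mem (inc u))) => [E Eu | inc0].
- have Ev : E \in inc v by rewrite -uv.
  have EE (w w' : G) (F : edge G) :
      w != w' -> w \in val F -> w' \in val F -> val F = [set w; w'].
    move=> ww' wF w'F; apply/esym/eqP.
    rewrite eqEcard subUset !sub1set wF w'F /= cards2 ww'.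
    case/existsP: (valP F) => a /existsP[b /andP[_ /eqP->]].
    by rewrite cards2; case: (a != b).
  have eqE : val E = [set u; v] by rewrite !inE in Eu Ev; apply: EE.
  case/negP: (hE E); apply/forallP => F; apply/implyP => FE.
  rewrite negbK; apply/eqP/setP => w; rewrite in_set0; apply/negP.
  rewrite inE => /andP[wE wF].
  have wuv : w \in [set u; v] by rewrite -eqE.
  have Fu : F \in inc u.
    move: wuv; rewrite in_set2 => /orP[]/eqP ew; last rewrite uv.
    - by rewrite inE -ew.
    - by rewrite inE -ew.
  have Fv : F \in inc v by rewrite -uv.
  rewrite !inE in Eu Ev Fu Fv.
  by case/eqP: FE; apply: val_inj; rewrite eqE; apply: EE.
- have iso (w : G) : inc w = inc u -> isolated_vertex w.
    move=> wu; apply/forallP => z; apply/negP => wz.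
    have hF : is_edge [set w; z].
      by apply/existsP; exists w; apply/existsP; exists z; rewrite wz eqxx.
    have := inc0 (Sub [set w; z] hF).
    by rewrite /= -wu inE /= set21.
  have : #|[set u; v]| <= 1.
    apply: leq_trans hV; apply/subset_leq_card/subsetP => w.
    by rewrite !inE => /orP[]/eqP->; apply: iso.
  by rewrite cards2 neq.
Qed.

Lemma inj_vertex_distinguishing n (G : sgraph) (T : finType)
    (g : edge G -> T) :
  F3s n G -> injective g -> vertex_distinguishing g.
Proof.
move=> hG g_inj; apply/forallP => u; apply/forallP => v; apply/implyP.
by apply: contra => /eqP /(imset_inj g_inj) /(inc_inj hG) ->.
Qed.

Lemma inj_proper_edge (G : sgraph) (T : finType) (g : edge G -> T) :
  injective g -> proper_edge_coloring g.
Proof.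
move=> g_inj; apply/forallP => E; apply/forallP => E'; apply/implyP.
by case/andP=> neq _; rewrite (inj_eq g_inj).
Qed.

Lemma ex_s_edge_colorable n (G : sgraph) :
  F3s n G -> exists k, s_edge_colorable G k.
Proof.
move=> hG; exists #|edge G|; apply/existsP; exists [ffun E => enum_rank E].
have g_inj : injective [ffun E : edge G => enum_rank E].
  by move=> E F; rewrite !ffunE => /enum_rank_inj.
by rewrite inj_proper_edge // (inj_vertex_distinguishing hG).
Qed.

Lemma ex_s_total_colorable n (G : sgraph) :
  F3s n G -> exists k, s_total_colorable G k.
Proof.
move=> hG; exists #|{: G + edge G}|; apply/existsP.
exists [ffun x => enum_rank x].
set f := finfun _.
have f_inj : injective f by move=> x y; rewrite !ffunE => /enum_rank_inj.
have g_inj : injective (fun E => f (inr E)) by move=> E F /f_inj [].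
rewrite (inj_vertex_distinguishing hG) // andbT.
apply/and3P; split; last 1 first.
- by apply/forallP => u; apply/forall_inP => E _; rewrite (inj_eq f_inj).
- apply/forallP => u; apply/forallP => v; apply/implyP => uv.
  rewrite (inj_eq f_inj); apply/eqP => -[ew].
  by rewrite ew adj_irrefl in uv.
- exact: inj_proper_edge.
Qed.

Lemma ex_as_total_colorable n (G : sgraph) :
  F3s n G -> exists k, as_total_colorable G k.
Proof.
case/ex_s_total_colorable => k /existsP[f /andP[fP /forallP fD]].
exists k; apply/existsP; exists f; rewrite fP /=.
apply/forallP => u; apply/forallP => v; apply/implyP => uv.
have /forallP/(_ v)/implyP := fD u; apply.
by apply: contraTneq uv => ->; rewrite adj_irrefl.
Qed.

(* The three parameters need not exist for an arbitrary graph (an isolated edge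
   rules all of them out); membership in F3s guarantees the minima below. *)
Definition chi_s' (n : nat) (G : sgraph) (hG : F3s n G) : nat :=
  ex_minn (ex_s_edge_colorable hG).

Definition chi_s'' (n : nat) (G : sgraph) (hG : F3s n G) : nat :=
  ex_minn (ex_s_total_colorable hG).

Definition chi_as'' (n : nat) (G : sgraph) (hG : F3s n G) : nat :=
  ex_minn (ex_as_total_colorable hG).

(* Main.v *)
(** For the second bound, a colouring of the edges is extended by giving the
    vertices of one side a new colour, and those of the other side a colour
    missing at them, or a second new colour.

    For the first bound, let D be the maximum degree. If at most one edge, with
    both ends of degree at least 2, crosses a cut, colour the two sides by
    induction and permute the colours on one side. Otherwise the core (the
    subgraph induced on the vertices of degree at least 2) is 2-edge-connected.
    Splitting vertices down to degree at most 3 by Fleischner's lemma, where a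
    parity join exists by mere connectivity, yields an edge set H whose degrees h
    have prescribed parity and satisfy |2h - d| <= 3. Prescribe opposite
    parities to the two sides: adjacent vertices of equal degree then see
    different numbers of H-edges. By Koenig's theorem, H and its complement can be
    coloured with disjoint palettes of D + 3 colours in total, and the windows for
    h leave a colour of the first palette free at each vertex of A and a colour of
    the second free at each vertex outside A, for the vertices themselves.
    Parity can fail at a single vertex, which is then distinguished by
    rearranging one or two colour classes. *)

Require Import Defs.
From mathcomp Require Import all_boot perm zify.

Set Implicit Arguments.
Unset Strict Implicit.
Unset Printing Implicit Defensive.

(** * Parity joins in multigraphs *)

Definition symdiff (T : finType) (X Y : {set T}) : {set T} :=
  (X :\: Y) :|: (Y :\: X).

Lemma odd_card_symdiff (T : finType) (X Y : {set T}) :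
  odd #|symdiff X Y| = odd #|X| (+) odd #|Y|.
Proof.
have := cardsUI (X :\: Y) (Y :\: X).
have -> : (X :\: Y) :&: (Y :\: X) = set0.
  by apply/setP => x; rewrite !inE; case: (x \in X); case: (x \in Y).
have := cardsID Y X; have := cardsID X Y.
rewrite cards0 (setIC Y X) /symdiff; lia.
Qed.

Lemma card_two (T : finType) (X : {set T}) (x y : T) :
  x != y -> #|X| = (x \in X) + (y \in X) + #|X :\ x :\ y|.
Proof.
move=> xy; rewrite (cardsD1 x) (cardsD1 y (X :\ x)) !inE eq_sym xy /=; lia.
Qed.

Section Multigraph.
Variables (V E : finType) (s t : E -> V).

(** Multigraphs are given by end maps [s] and [t] on a fixed edge type: splitting a vertex changes
    only the maps, and subsets of [E] keep their meaning. A loop would count once in [sdeg], but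
    [edges_on] excludes loops. *)
Definition joins (e : E) (v : V) : bool := (s e == v) || (t e == v).

Definition sdeg (F : {set E}) (v : V) : nat := #|[set e in F | joins e v]|.

Definition cut (F : {set E}) (Z : {set V}) : {set E} :=
  [set e in F | (s e \in Z) != (t e \in Z)].

Definition splits (C Z : {set V}) : bool :=
  (C :&: Z != set0) && (C :\: Z != set0).

Definition edges_on (C : {set V}) (F : {set E}) : Prop :=
  forall e, e \in F -> [/\ s e \in C, t e \in C & s e != t e].

Definition edge_connected (k : nat) (C : {set V}) (F : {set E}) : Prop :=
  forall Z, splits C Z -> k <= #|cut F Z|.

Lemma sdeg_symdiff (X Y : {set E}) v :
  odd (sdeg (symdiff X Y) v) = odd (sdeg X v) (+) odd (sdeg Y v).
Proof.
rewrite /sdeg -odd_card_symdiff; congr (odd #|pred_of_set _|).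
by apply/setP => e; rewrite !inE; case: (e \in X); case: (e \in Y); case: joins.
Qed.

Lemma sdeg0 v : sdeg set0 v = 0.
Proof. by apply: eq_card0 => e; rewrite !inE. Qed.

Lemma sdegS (X Y : {set E}) v : X \subset Y -> sdeg X v <= sdeg Y v.
Proof.
move=> /subsetP XY; apply/subset_leq_card/subsetP => e.
by rewrite !inE => /andP[/XY-> ->].
Qed.

Lemma sdegD (X Y : {set E}) v :
  X \subset Y -> sdeg Y v = sdeg X v + sdeg (Y :\: X) v.
Proof.
move=> /subsetP XY; rewrite /sdeg -(cardsID X [set e in Y | joins e v]).
congr addn; apply: eq_card => e; rewrite !inE.
- by case: (boolP (e \in X)) => [/XY->|]; rewrite ?andbT ?andbF.
- by case: (e \in X).
Qed.

Lemma sdeg1 e v : sdeg [set e] v = joins e v.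
Proof.
rewrite /sdeg; case: (boolP (joins e v)) => ev.
- by apply/eqP/cards1P; exists e; apply/setP => x; rewrite !inE; case: eqP => // ->.
- by apply: eq_card0 => x; rewrite !inE; case: eqP => // ->; apply/negbTE.
Qed.

Lemma symdiff_sub (T : finType) (X Y D : {set T}) :
  X \subset D -> Y \subset D -> symdiff X Y \subset D.
Proof.
by move=> XD YD; rewrite subUset !(subset_trans (subsetDl _ _)).
Qed.

(** Toggling an edge of [D] moves the odd end [w] across it, so no edge of [D] leaves the set [Z] of
    attainable [w], and connectedness puts [C] inside [Z]. For [w = r] all degrees are even. *)
Lemma odd_path (C : {set V}) (D : {set E}) r :
  r \in C -> edges_on C D -> edge_connected 1 C D ->
  forall w, w \in C -> exists2 Y : {set E}, Y \subset D &
    forall v, odd (sdeg Y v) = (v == r) (+) (v == w).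
Proof.
move=> rC DC conn.
pose Z := [set w | [exists Y : {set E}, (Y \subset D) &&
  [forall v, odd (sdeg Y v) == (v == r) (+) (v == w)]]].
have ZP w : reflect (exists2 Y : {set E}, Y \subset D &
    forall v, odd (sdeg Y v) = (v == r) (+) (v == w)) (w \in Z).
  rewrite inE; apply: (iffP existsP) => [[Y /andP[YD /forallP h]]|[Y YD h]].
  - by exists Y => // v; apply/eqP.
  - by exists Y; rewrite YD; apply/forallP => v; apply/eqP.
have rZ : r \in Z.
  by apply/ZP; exists set0; rewrite ?sub0set // => v; rewrite sdeg0 addbb.
have step e u w : e \in D -> u \in Z ->
    (forall v, joins e v = (v == u) (+) (v == w)) -> w \in Z.
  move=> eD /ZP[Y YD h] eu; apply/ZP; exists (symdiff Y [set e]).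
  - by apply: symdiff_sub; rewrite // sub1set.
  - move=> v; rewrite sdeg_symdiff h sdeg1 eu.
    by case: (v == r); case: (v == u); case: (v == w).
have CZ : C \subset Z.
  apply/negPn/negP; rewrite -setD_eq0 => CZ.
  have /conn : splits C Z by rewrite /splits CZ andbT; apply/set0Pn; exists r; rewrite in_setI rC.
  case/card_gt0P => e; rewrite inE => /andP[eD].
  have [sC tC st] := DC e eD.
  have ej v : joins e v = (v == s e) (+) (v == t e).
    rewrite /joins ![_ == v]eq_sym; case: (eqVneq v (s e)) => // ->.
    by rewrite (negbTE st).
  have ej' v : joins e v = (v == t e) (+) (v == s e) by rewrite addbC.
  suff -> : (s e \in Z) = (t e \in Z) by rewrite eqxx.
  by apply/idP/idP => h; [apply: (step e _ _ eD h ej)|apply: (step e _ _ eD h ej')].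
by move=> w wC; apply/ZP/(subsetP CZ).
Qed.

(** Take the symmetric difference of odd paths from [r] to the vertices of [C] satisfying [T]; the
    uncontrolled parity at [r] absorbs the handshake constraint. *)
Lemma odd_join (C : {set V}) (D : {set E}) r (T : V -> bool) :
  r \in C -> edges_on C D -> edge_connected 1 C D ->
  exists2 X : {set E}, X \subset D &
    forall v, v \in C -> v != r -> odd (sdeg X v) = T v.
Proof.
move=> rC DC conn.
have aux (l : seq V) : {subset l <= C} -> exists2 X : {set E}, X \subset D &
    forall v, v != r -> odd (sdeg X v) = odd (count_mem v l).
  elim: l => [|w l IH] lC; first by exists set0; rewrite ?sub0set // => v _; rewrite sdeg0.
  have [|X XD hX] := IH; first by move=> v vl; apply: lC; rewrite inE vl orbT.
  have [Y YD hY] := odd_path rC DC conn (lC w (mem_head _ _)).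
  exists (symdiff Y X); first exact: symdiff_sub.
  move=> v vr; rewrite sdeg_symdiff hX // hY /= oddD (negbTE vr).
  by rewrite eq_sym; case: (w == v).
have [|X XD hX] := aux (enum [set v in C | T v]).
  by move=> v; rewrite mem_enum inE => /andP[].
exists X => // v vC vr; rewrite hX // count_uniq_mem ?enum_uniq //.
by rewrite mem_enum inE vC; case: (T v).
Qed.

(* Maximum degree 3: parity is the only constraint, except that at the root the
   join must not take all or none of three edges; if it does, flip a cycle. *)
Lemma subcubic_join (C : {set V}) (F : {set E}) r (T : V -> bool) :
  r \in C -> edges_on C F -> edge_connected 2 C F ->
  (forall v, v \in C -> sdeg F v <= 3) ->
  exists X : {set E}, [/\ X \subset F,
    forall v, v \in C -> v != r -> odd (sdeg X v) = T v,
    forall v, v \in C -> 2 * sdeg X v <= sdeg F v + 3 /\ sdeg F v <= 2 * sdeg X v + 3 &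
    2 * sdeg X r <= sdeg F r + 2 /\ sdeg F r <= 2 * sdeg X r + 2].
Proof.
move=> rC FC conn d3.
have conn1 : edge_connected 1 C F by move=> Z /conn; apply: ltnW.
have [X XF hX] := odd_join T rC FC conn1.
have bnd (Y : {set E}) v : Y \subset F -> v \in C ->
    2 * sdeg Y v <= sdeg F v + 3 /\ sdeg F v <= 2 * sdeg Y v + 3.
  by move=> YF vC; have := sdegS v YF; have := d3 v vC; clear; lia.
case: (boolP ((sdeg F r == 3) && ((sdeg X r == 0) || (sdeg X r == 3)))); last first.
  move=> h; exists X; split=> //; first by move=> v; apply: bnd.
  by have := sdegS r XF; have := d3 r rC; lia.
case/andP=> /eqP dr Xr.
have /card_gt0P[e0] : 0 < #|[set e in F | joins e r]| by rewrite -/(sdeg F r) dr.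
rewrite inE => /andP[e0F e0r].
have [sC tC st] := FC e0 e0F.
pose w0 := if s e0 == r then t e0 else s e0.
have e0j v : joins e0 v = (v == r) (+) (v == w0).
  rewrite /joins /w0; move: e0r; rewrite /joins; case: (eqVneq (s e0) r) => [<- _|sr /= /eqP tr].
  - rewrite ![_ == v]eq_sym; case: (eqVneq v (s e0)) => // ->.
    by rewrite (negbTE st).
  - rewrite -tr ![_ == v]eq_sym; case: (eqVneq v (s e0)) => [-> | _].
    + by rewrite (negbTE st).
    + by rewrite addbF.
have w0C : w0 \in C by rewrite /w0; case: ifP.
have DC : edges_on C (F :\ e0) by move=> e; rewrite !inE => /andP[_ /FC].
have connD : edge_connected 1 C (F :\ e0).
  move=> Z /conn h; have := cardsD1 e0 (cut F Z).
  have -> : cut F Z :\ e0 = cut (F :\ e0) Z.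
    by apply/setP => e; rewrite !inE andbA.
  by case: (e0 \in _) h; clear; lia.
(* By 2-edge-connectivity the graph stays connected without [e0], so a join of the two ends of [e0]
   closes up with [e0] to an even set [Q], of degree 2 at [r]. *)
have [Y YD hY] := odd_path rC DC connD w0C.
have YF : Y \subset F := subset_trans YD (subsetDl _ _).
have e0Y : e0 \notin Y by apply/negP => /(subsetP YD); rewrite !inE eqxx.
pose Q := e0 |: Y.
have QF : Q \subset F by rewrite subUset sub1set e0F.
have Qj v : sdeg Q v = joins e0 v + sdeg Y v.
  rewrite (sdegD v (subsetUl [set e0] Y : [set e0] \subset Q)) sdeg1; congr addn.
  congr sdeg; apply/setP => e; rewrite !inE; case: eqP => // -> /=.
  by rewrite (negbTE e0Y).
have Qev v : ~~ odd (sdeg Q v).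
  by rewrite Qj oddD hY e0j; case: (v == r); case: (v == w0).
have Qr : sdeg Q r = 2.
  by have := Qev r; have := sdegS r QF; rewrite dr Qj e0r; clear; lia.
exists (symdiff X Q); split.
- exact: symdiff_sub.
- by move=> v vC vr; rewrite sdeg_symdiff (negbTE (Qev v)) addbF hX.
- by move=> v vC; apply: bnd => //; apply: symdiff_sub.
(* Toggling [Q] turns degree 0 at [r] into 2 and degree 3 into 1, both within the root bound. *)
have XQ : sdeg (symdiff X Q) r = (if sdeg X r == 0 then 2 else 1).
  case: (boolP (sdeg X r == 0)) Xr => /= [X0 _|_ /eqP X3].
  - rewrite -Qr; apply: eq_card => e; rewrite !inE.
    move/eqP/cards0_eq/setP/(_ e): X0; rewrite !inE.
    by case: (e \in X); case: joins; rewrite ?andbF ?orbF ?andbT //=.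
  - have Xall : [set e in X | joins e r] = [set e in F | joins e r].
      apply/eqP; rewrite eqEcard -/(sdeg F r) -/(sdeg X r) X3 dr leqnn andbT.
      by apply/subsetP => e; rewrite !inE => /andP[/(subsetP XF)-> ->].
    have := sdegD r QF; rewrite dr Qr => -[h].
    suff -> : sdeg (symdiff X Q) r = sdeg (F :\: Q) r by move: h; clear; lia.
    apply: eq_card => e; move/setP/(_ e): Xall; rewrite !inE.
    case: (boolP (e == e0)) => [/eqP->|_] /=.
      by rewrite e0r e0F !andbT => ->; rewrite ?andbF.
    case: joins; rewrite ?andbF //= !andbT => ->.
    case: (boolP (e \in Y)) => [/(subsetP YF)-> //|_] /=; by rewrite andbF orbF.
by rewrite XQ dr; case: ifP.
Qed.

End Multigraph.

(** * Splitting off a pair of edges *)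

Lemma card_cut (V E : finType) (s t : E -> V) (F : {set E}) (Z : {set V}) :
  #|cut s t F Z| = \sum_(e in F) ((s e \in Z) != (t e \in Z)).
Proof.
rewrite -sum1dep_card big_mkcondr /=.
by apply: eq_bigr => e _; case: (_ != _).
Qed.

Definition other_end (V E : finType) (s t : E -> V) (v : V) (e : E) : V :=
  if s e == v then t e else s e.

Lemma splitsI (V : finType) (C Z : {set V}) u w :
  u \in C -> u \in Z -> w \in C -> w \notin Z -> splits C Z.
Proof.
move=> uC uZ wC wZ; apply/andP; split; apply/set0Pn.
- by exists u; rewrite inE uC.
- by exists w; rewrite inE wZ.
Qed.

(* Fleischner's splitting lemma. [Z] below is a maximal set certifying that some
   pair at [v] cannot be split off; uncrossing it with a second certificate [Z']
   forces all inequalities to be tight and contradicts parity. *)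
Lemma splittable_pair (V E : finType) (s t : E -> V) (C : {set V}) (F : {set E}) v :
  v \in C -> edges_on s t C F -> edge_connected s t 2 C F -> 3 < sdeg s t F v ->
  exists g b, [/\ g != b, g \in F /\ b \in F, joins s t g v /\ joins s t b v &
    forall Z : {set V}, v \notin Z -> other_end s t v g \in Z ->
      other_end s t v b \in Z -> 3 < #|cut s t F Z|].
Proof.
move=> vC FC conn dv.
pose o := other_end s t v.
pose arms := [set e in F | joins s t e v].
have armP e : e \in arms -> e \in F /\ joins s t e v by rewrite inE => /andP.
have oC e : e \in arms -> o e \in C.
  by move=> /armP[/FC[sC tC _] _]; rewrite /o /other_end; case: ifP.
have crossE (e : E) (Z : {set V}) : e \in arms -> v \notin Z ->
    ((s e \in Z) != (t e \in Z)) = (o e \in Z).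
  move=> /armP[eF]; rewrite /joins /o /other_end => ev vZ.
  case: (eqVneq (s e) v) ev => [-> _|_ /= /eqP->]; rewrite (negbTE vZ);
    by case: (_ \in Z).
have /card_gt0P[g garm] : 0 < #|arms| by apply: leq_trans dv.
case: (boolP [exists b, [&& b != g, b \in arms & [forall Z : {set V},
    [&& v \notin Z, o g \in Z & o b \in Z] ==> (3 < #|cut s t F Z|)]]]).
  case/existsP => b /and3P[bg barm /forallP h]; exists g, b.
  have [gF gv] := armP g garm; have [bF bv] := armP b barm.
  rewrite eq_sym bg; split=> // Z vZ gZ bZ.
  by have := h Z; rewrite /o vZ gZ bZ.
move/existsPn => no; exfalso.
have bad b : b != g -> b \in arms -> exists Z : {set V},
    [/\ v \notin Z, o g \in Z, o b \in Z & #|cut s t F Z| <= 3].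
  move=> bg barm; have := no b; rewrite bg barm /= => /forallPn[Z].
  rewrite negb_imply -leqNgt => /andP[/and3P[? ? ?] ?]; by exists Z.
pose dang (Z : {set V}) := [&& v \notin Z, o g \in Z,
  [exists a, [&& a != g, a \in arms & o a \in Z]] & #|cut s t F Z| <= 3].
have dangI b (Z : {set V}) : b != g -> b \in arms -> v \notin Z -> o g \in Z -> o b \in Z ->
    #|cut s t F Z| <= 3 -> dang Z.
  by move=> bg ba vZ gZ bZ cZ; rewrite /dang vZ gZ cZ andbT; apply/existsP; exists b; apply/and3P.
have [a0 a0g a0arm] : exists2 a0, a0 != g & a0 \in arms.
  have /card_gt0P[a] : 0 < #|arms :\ g|.
    by have := cardsD1 g arms; rewrite garm; move: dv; rewrite /sdeg -/arms; lia.
  by rewrite !inE => /andP[? ?]; exists a; rewrite ?inE.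
have [Z0 [vZ0 gZ0 aZ0 cZ0]] := bad a0 a0g a0arm.
have dZ0 := dangI a0 Z0 a0g a0arm vZ0 gZ0 aZ0 cZ0.
(* Maximality is measured inside [C], because [conn] says nothing about sets that miss [C]. *)
case: (arg_maxnP (fun Z : {set V} => #|C :&: Z|) dZ0) => Z /and4P[vZ gZ /existsP[a /and3P[ag aarm aZ]] cZ] Zmax.
(* More than 3 edges meet [v], and each one leading into [Z] crosses its boundary, so some arm ends
   outside [Z]. *)
have [b barm bZ] : exists2 b, b \in arms & o b \notin Z.
  apply/exists_inP; rewrite -negb_forall_in; apply/negP => /forall_inP all.
  suff : #|arms| <= #|cut s t F Z|.
    by move=> h; have := leq_trans (leq_trans dv h) cZ; rewrite ltnn.
  apply/subset_leq_card/subsetP => e earm; rewrite inE crossE // all //.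
  by case: (armP e earm) => ->.
have bg : b != g by apply: contraNneq bZ => ->.
have [Z' [vZ' gZ' bZ' cZ']] := bad b bg barm.
have grow (U : {set V}) : dang U -> #|C :&: Z| < #|C :&: U| -> False.
  by move=> dU /leq_trans/(_ (Zmax U dU)); rewrite ltnn.
have bigger (U : {set V}) : C :&: Z \subset U -> o b \in U -> #|C :&: Z| < #|C :&: U|.
  move=> ZU bU; apply: proper_card; apply/properP; split.
    by rewrite subsetI subsetIl.
  by exists (o b); rewrite !inE ?(oC b barm) ?bU //= negb_and bZ orbT.
have cU : 3 < #|cut s t F (Z :|: Z')|.
  rewrite ltnNge; apply/negP => cU; apply: (grow (Z :|: Z')).
    by apply: (dangI a) => //; rewrite !inE ?negb_or ?vZ ?gZ ?aZ.
  apply: bigger; last by rewrite inE bZ' orbT.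
  exact: subset_trans (subsetIr _ _) (subsetUl _ _).
have cW : 1 < #|cut s t F (Z :&: Z')|.
  by apply/conn/(splitsI (oC g garm) _ vC); rewrite !inE ?gZ ?negb_and ?vZ.
have cD' : 1 < #|cut s t F (Z' :\: Z)|.
  by apply/conn/(splitsI (oC b barm) _ vC); rewrite !inE ?bZ ?negb_and ?vZ'  ?orbT.
have cD : 1 < #|cut s t F (Z :\: Z')|.
  (* If [Z'] contained [C :&: Z], it would be a larger certificate, since it also contains [o b]. *)
  case: (boolP (C :&: (Z :\: Z') == set0)) => [/eqP D0|/set0Pn[u]].
    exfalso; apply: (grow Z'); first exact: (dangI b).
    apply: bigger => //; apply/subsetP => u /setIP[uC uZ].
    move/setP/(_ u): D0; rewrite !inE uC uZ /=.
    by case: (u \in Z').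
  rewrite inE => /andP[uC uD].
  by apply/conn/(splitsI uC uD vC); rewrite !inE negb_and vZ orbT.
have sub : #|cut s t F (Z :&: Z')| + #|cut s t F (Z :|: Z')| <=
    #|cut s t F Z| + #|cut s t F Z'|.
  rewrite !card_cut -!big_split /=; apply: leq_sum => e _; rewrite !inE.
  by case: (s e \in Z); case: (s e \in Z'); case: (t e \in Z); case: (t e \in Z').
(* The additional 2 comes from [g]: it runs from [v], outside both sets, into their intersection, so
   it crosses [Z] and [Z'] but neither difference. *)
have posi : #|cut s t F (Z :\: Z')| + #|cut s t F (Z' :\: Z)| + 2 <=
    #|cut s t F Z| + #|cut s t F Z'|.
  have [gF _] := armP g garm.
  rewrite !card_cut -!big_split /= (bigD1 g) //= [leqRHS](bigD1 g) //=.
  rewrite !crossE // !inE ?negb_and ?vZ ?vZ' ?gZ ?gZ' ?orbT //=.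
  rewrite addnC addnA leq_add2l; apply: leq_sum => e _; rewrite !inE.
  by case: (s e \in Z); case: (s e \in Z'); case: (t e \in Z); case: (t e \in Z').
have par : odd #|cut s t F Z| = odd #|cut s t F (Z :\: Z')| (+) odd #|cut s t F (Z :&: Z')|.
  rewrite !card_cut -oddD -big_split /= !(big_morph odd oddD erefl).
  apply: eq_bigr => e _; rewrite !inE.
  by case: (s e \in Z); case: (s e \in Z'); case: (t e \in Z); case: (t e \in Z').
(* All bounds are tight: the cuts of [Z] and [Z'] have size 3, that of the union 4, those of the
   intersection and both differences 2. Then [par] makes 3 even. *)
clear -cZ cZ' cU cW cD cD' sub posi par.
lia.
Qed.

Section SplitOff.

(** * Degrees and 2-edge-connectivity after splitting off a pair *)

Variables (V E : finType) (s t : E -> V) (C : {set V}) (F : {set E}).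
Variables (v : V) (g b : E).
Hypotheses (gb : g != b) (gv : joins s t g v) (bv : joins s t b v).
Hypotheses (FC : edges_on s t C F) (gF : g \in F) (bF : b \in F).

(** The new vertex [None] takes over the [v]-ends of [g] and [b]; what remains of [v] becomes
    [Some v]. *)
Let moved (f : E -> V) (e : E) : option V :=
  if ((e == g) || (e == b)) && (f e == v) then None else Some (f e).
Let s' := moved s.
Let t' := moved t.
Definition split_vertices : {set option V} :=
  [set w | if w is Some u then u \in C else true].

Definition split_source := s'.
Definition split_target := t'.

Let joinsNone e : joins s' t' e None = (e == g) || (e == b).
Proof.
rewrite /joins /s' /t' /moved; case: (boolP ((e == g) || (e == b))) => //= h.
have : joins s t e v by case/orP: h => /eqP->.
by rewrite /joins; case: (s e == v); case: (t e == v).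
Qed.

Let joinsSome e u :
  joins s' t' e (Some u) = joins s t e u && ~~ ((u == v) && ((e == g) || (e == b))).
Proof.
rewrite /joins /s' /t' /moved; case: ((e == g) || (e == b)); rewrite ?andbT ?andbF /=.
- case: (eqVneq u v) => [->|uv]; rewrite ?andbT ?andbF /=.
  + by case: (eqVneq (s e) v) => [|sv]; case: (eqVneq (t e) v) => [|tv] //=;
      rewrite ?(inj_eq Some_inj) ?(negbTE sv) ?(negbTE tv).
  + by case: (eqVneq (s e) v) => [->|sv]; case: (eqVneq (t e) v) => [->|tv] //=;
      rewrite ?(inj_eq Some_inj) ?[v == u]eq_sym ?(negbTE uv).
- by rewrite andbT.
Qed.

Lemma sdeg_splitNone (X : {set E}) : sdeg s' t' X None = (g \in X) + (b \in X).
Proof.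
rewrite /sdeg (card_two _ gb) !inE !joinsNone !eqxx orbT !andbT.
rewrite [X in _ + X = _](_ : _ = 0) ?addn0 //; apply: eq_card0 => e.
by rewrite !inE joinsNone; case: (e == g); case: (e == b); rewrite ?andbF.
Qed.

Lemma sdeg_splitSome (X : {set E}) u : u != v -> sdeg s' t' X (Some u) = sdeg s t X u.
Proof.
by move=> uv; apply: eq_card => e; rewrite !inE joinsSome (negbTE uv) andbT.
Qed.

Lemma sdeg_split (X : {set E}) :
  sdeg s t X v = sdeg s' t' X (Some v) + ((g \in X) + (b \in X)).
Proof.
rewrite /sdeg (card_two _ gb) !inE gv bv !andbT addnC; congr addn.
apply: eq_card => e; rewrite !inE joinsSome eqxx negb_or.
by case: (e == g); case: (e == b); rewrite ?andbF ?andbT.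
Qed.

Lemma edges_on_split : edges_on s' t' split_vertices F.
Proof.
move=> e eF; have [sC tC st] := FC eF; rewrite !inE /s' /t' /moved; split.
- by case: ifP.
- by case: ifP.
case: ((e == g) || (e == b)) => //=.
case: (eqVneq (s e) v) => [sv|_]; case: (eqVneq (t e) v) => [tv|_] //.
by case/eqP: st; rewrite sv.
Qed.

Hypothesis vC : v \in C.
Hypothesis conn : edge_connected s t 2 C F.
Hypothesis safe : forall Z : {set V}, v \notin Z -> other_end s t v g \in Z ->
      other_end s t v b \in Z -> 3 < #|cut s t F Z|.

(** Up to complement, [Some v] is outside [Z]. If [None] is too, the cut is an old one. Otherwise
    only [g] and [b] change status: each crosses now exactly when its other end is outside [Z0], and
    crossed before exactly when it is inside. Two ends inside cost 2 of at least 4 edges by [safe],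
    one costs nothing, and with none inside [g] and [b] both cross. *)
Lemma edge_connected_split : edge_connected s' t' 2 split_vertices F.
Proof.
suff main (Z : {set option V}) : Some v \notin Z -> splits split_vertices Z ->
    1 < #|cut s' t' F Z|.
  move=> Z ZC; case: (boolP (Some v \in Z)) => vZ; last exact: main.
  have -> : cut s' t' F Z = cut s' t' F (~: Z).
    by apply/setP => e; rewrite !inE; case: (_ \in Z); case: (_ \in Z).
  apply: main; first by rewrite inE vZ.
  by move: ZC; rewrite /splits andbC setDE [_ :\: ~: _]setDE setCK.
move=> vZ /andP[/set0Pn[w /setIP[wC wZ]] _].
pose Z0 := [set u | Some u \in Z].
have vZ0 : v \notin Z0 by rewrite inE.
have cutE e : (e == g) || (e == b) = false ->
    ((s' e \in Z) != (t' e \in Z)) = ((s e \in Z0) != (t e \in Z0)).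
  by move=> h; rewrite /s' /t' /moved h /= !inE.
have conn0 : forall u, u \in C -> u \in Z0 -> 1 < #|cut s t F Z0|.
  by move=> u uC uZ; apply/conn/(splitsI uC uZ vC).
case: (boolP (None \in Z)) => NZ; last first.
  case: w wC wZ => [u|] wC wZ; last by rewrite wZ in NZ.
  rewrite inE in wC; have := conn0 u wC; rewrite inE wZ => /(_ isT) h.
  apply: (leq_trans h); apply: eq_leq; apply: eq_card => e; rewrite ![in RHS]inE ![in LHS]inE.
  congr andb; rewrite /s' /t' /moved.
  by case: ((e == g) || (e == b)); case: (eqVneq (s e) v) => [->|_];
    case: (eqVneq (t e) v) => [->|_]; rewrite /= ?inE ?(negbTE NZ) ?(negbTE vZ).
have mv e : (e == g) || (e == b) -> e \in F -> joins s t e v ->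
    [/\ ((s' e \in Z) != (t' e \in Z)) = (other_end s t v e \notin Z0),
      ((s e \in Z0) != (t e \in Z0)) = (other_end s t v e \in Z0) &
      other_end s t v e \in C].
  move=> egb /FC[sC tC st]; rewrite /s' /t' /moved egb /joins /other_end /=.
  case: (eqVneq (s e) v) st => [-> vt _|sv _ /= /eqP tv].
  - by rewrite [t e == v]eq_sym (negbTE vt) !inE NZ (negbTE vZ); case: (_ \in Z).
  - by rewrite tv eqxx !inE NZ (negbTE vZ); case: (_ \in Z).
have [g1 g2 oC] := mv g (predU1l _ (erefl _)) gF gv.
have [b1 b2 o'C] : [/\ ((s' b \in Z) != (t' b \in Z)) = (other_end s t v b \notin Z0),
      ((s b \in Z0) != (t b \in Z0)) = (other_end s t v b \in Z0) &
      other_end s t v b \in C] by apply: mv; rewrite ?eqxx ?orbT.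
have bg : b != g by rewrite eq_sym.
have D X (f : E -> bool) : X = \sum_(e in F) f e ->
    X = f g + (f b + \sum_(e in F | (e != g) && (e != b)) f e).
  move=> ->; rewrite (bigD1 g) //= (bigD1 b) /= ?bF //.
  by congr (_ + (_ + _)); apply: eq_bigl => e; rewrite andbA.
have c1 := D _ _ (card_cut s' t' F Z).
have c0 := D _ _ (card_cut s t F Z0).
rewrite g1 b1 in c1; rewrite g2 b2 in c0.
have R : \sum_(e in F | (e != g) && (e != b)) ((s' e \in Z) != (t' e \in Z)) =
    \sum_(e in F | (e != g) && (e != b)) ((s e \in Z0) != (t e \in Z0)).
  by apply: eq_bigr => e /andP[_ /andP[/negbTE eg /negbTE eb]]; rewrite cutE // eg eb.
rewrite R in c1.
have h1 := conn0 _ oC; have h2 := conn0 _ o'C; have h3 := safe vZ0.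
move: c0 c1 h1 h2 h3; case: (_ \in Z0); case: (_ \in Z0) => /= -> -> h1 h2 h3.
- by have := h3 isT isT.
- by have := h1 isT.
- by have := h2 isT.
- by [].
Qed.


End SplitOff.

Lemma sum_split_vertices (V : finType) (C : {set V}) (f : option V -> nat) :
  \sum_(w in split_vertices C) f w = f None + \sum_(u in C) f (Some u).
Proof.
rewrite (bigD1 None) ?inE //=; congr addn.
rewrite (reindex_omap Some id) => [|[u|] // /andP[_ /eqP]] //=.
by apply: eq_bigl => u; rewrite !inE eqxx !andbT.
Qed.

(** Induction on the total excess of the degrees over 3: splitting off a pair lowers the degree of
    [v] by 2 and creates a vertex of degree 2, until [subcubic_join] applies. *)
Lemma balanced_join (V E : finType) (s t : E -> V) (C : {set V}) (F : {set E}) r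
    (T : V -> bool) :
  r \in C -> edges_on s t C F -> edge_connected s t 2 C F ->
  exists X : {set E}, [/\ X \subset F,
    forall v, v \in C -> v != r -> odd (sdeg s t X v) = T v,
    forall v, v \in C -> 2 * sdeg s t X v <= sdeg s t F v + 3 /\
                        sdeg s t F v <= 2 * sdeg s t X v + 3 &
    2 * sdeg s t X r <= sdeg s t F r + 2 /\ sdeg s t F r <= 2 * sdeg s t X r + 2].
Proof.
have [n] := ubnP (\sum_(v in C) (sdeg s t F v - 3)).
elim: n V s t C r T => // n IH V s t C r T ltn rC FC conn.
case: (boolP [exists v in C, 3 < sdeg s t F v]) => [|/exists_inPn small]; last first.
  by apply: subcubic_join => // v vC; rewrite leqNgt small.
case/exists_inP => v vC dv.
have [g [b [gb [gF bF] [gv bv] safe]]] := splittable_pair vC FC conn dv.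
set s' := split_source s v g b; set t' := split_target t v g b.
have dN X : sdeg s' t' X None = (g \in X) + (b \in X) := sdeg_splitNone gb gv bv X.
have dS X u : u != v -> sdeg s' t' X (Some u) = sdeg s t X u.
  by move=> uv; apply: sdeg_splitSome.
have dv' X : sdeg s t X v = sdeg s' t' X (Some v) + ((g \in X) + (b \in X)).
  exact: sdeg_split.
(* Odd degree at [None] forces exactly one of [g], [b] into [X]. Merging [None] back adds 1 to the
   degree of [v] in [X], hence the flipped target at [v], and 2 to its degree in [F], so the
   imbalance at [v] is unchanged. *)
have := IH _ s' t' (split_vertices C) (Some r)
  (fun w => if w is Some u then (u == v) (+) T u else true).
case.
- rewrite sum_split_vertices dN gF bF add0n.
  rewrite (bigD1 v) //= in ltn; rewrite (bigD1 v) //=.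
  have -> : \sum_(u in C | u != v) (sdeg s' t' F (Some u) - 3) =
            \sum_(u in C | u != v) (sdeg s t F u - 3).
    by apply: eq_bigr => u /andP[_ uv]; rewrite dS.
  have := dv' F; rewrite gF bF => h; move: ltn dv; rewrite h; clear; lia.
- by rewrite inE.
- exact: edges_on_split.
- exact: edge_connected_split.
move=> X [XF par bnd rbnd].
have XN : (g \in X) + (b \in X) = 1.
  have := par None; rewrite inE dN => /(_ isT isT).
  by case: (g \in X); case: (b \in X).
have tr k u : u \in C ->
    2 * sdeg s' t' X (Some u) <= sdeg s' t' F (Some u) + k /\
      sdeg s' t' F (Some u) <= 2 * sdeg s' t' X (Some u) + k ->
    2 * sdeg s t X u <= sdeg s t F u + k /\ sdeg s t F u <= 2 * sdeg s t X u + k.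
  move=> uC; case: (eqVneq u v) => [->|uv]; last by rewrite !dS.
  by rewrite !dv' gF bF XN; clear; lia.
exists X; split=> //.
- move=> u uC ur; have := par (Some u); rewrite inE uC (inj_eq Some_inj) ur => /(_ isT isT).
  case: (eqVneq u v) => [->|uv]; last by rewrite dS.
  by rewrite dv' XN addn1 /= => ->; rewrite negbK.
- by move=> u uC; apply: tr => //; apply: bnd; rewrite inE.
- exact: tr.
Qed.

(** * Edge colourings of bipartite graphs *)

Lemma connect_last (V : finType) (e : rel V) x y :
  connect e x y -> x != y -> exists2 z, connect e x z & e z y.
Proof.
case/connectP => p; case/lastP: p => [|p z] /= + -> xy; first by rewrite eqxx in xy.
rewrite rcons_path last_rcons => /andP[px ez].
by exists (last x p) => //; apply/connectP; exists p.
Qed.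

Section BipartiteColoring.
Variables (V E K : finType) (al be : E -> V) (A : {set V}) (k0 : K).
Hypotheses (alA : forall e, al e \in A) (beA : forall e, be e \notin A).

Notation jn := (joins al be).
Notation deg := (sdeg al be).

Definition proper_on (F : {set E}) (c : E -> K) : Prop :=
  forall v e e', e \in F -> e' \in F -> jn e v -> jn e' v -> c e = c e' -> e = e'.

Definition colors_at (c : E -> K) (F : {set E}) (v : V) : {set K} :=
  [set c e | e in [set e in F | jn e v]].

Lemma colors_atP c (F : {set E}) v k :
  reflect (exists e, [/\ e \in F, jn e v & k = c e]) (k \in colors_at c F v).
Proof.
apply: (iffP imsetP) => [[e]|[e [eF ev ->]]].
- by rewrite inE => /andP[eF ev] ->; exists e.
- by exists e => //; rewrite inE eF.
Qed.

Lemma card_colors_at c (F : {set E}) v : proper_on F c -> #|colors_at c F v| = deg F v.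
Proof.
move=> cF; apply: card_in_imset => e e'.
by rewrite !inE => /andP[eF ev] /andP[e'F e'v]; exact: (cF v).
Qed.

Lemma free_color c (F : {set E}) v (S : {set K}) :
  deg F v < #|S| -> exists2 k, k \in S & k \notin colors_at c F v.
Proof.
move=> lt; have : ~~ (S \subset colors_at c F v).
  apply/negP => /subset_leq_card/leq_trans/(_ (leq_imset_card _ _)).
  by rewrite leqNgt lt.
by case/subsetPn => k kS kc; exists k.
Qed.

Lemma jn_al e v : v \in A -> jn e v = (al e == v).
Proof.
move=> vA; rewrite /joins; case: (eqVneq (be e) v) => [bv|]; last by rewrite orbF.
by have := beA e; rewrite bv vA.
Qed.

Lemma jn_be e v : v \notin A -> jn e v = (be e == v).
Proof.
move=> vA; rewrite /joins; case: (eqVneq (al e) v) => [av|] //.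
by have := alA e; rewrite av (negbTE vA).
Qed.

(* Koenig's line colouring theorem, by Kempe chains: the [x]/[y]-chain starting
   at the [A]-end [al e] of the new edge enters vertices outside [A] along colour
   [y] only, so it cannot reach [be e], where [y] is missing. *)
Lemma konig (F : {set E}) (S : {set K}) : (forall v, deg F v <= #|S|) ->
  exists2 c, proper_on F c & forall e, e \in F -> c e \in S.
Proof.
have [n] := ubnP #|F|; elim: n F => // n IH F ltn dS.
case: (set_0Vmem F) => [F0|[e eF]].
  by exists (fun=> k0) => [v e e'|e]; rewrite F0 inE.
pose F' := F :\ e.
have F'F : F' \subset F := subsetDl _ _.
have [||c cF' cS] := IH F'.
- by move: ltn; rewrite (cardsD1 e F) eF.
- by move=> v; apply: leq_trans (dS v); apply: sdegS.
have dF' v : jn e v -> deg F' v < #|S|.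
  move=> ev; apply: leq_trans (dS v).
  have eq1 : deg F v = deg F' v + deg (F :\: F') v := sdegD al be v F'F.
  have : 0 < deg (F :\: F') v.
    by apply/card_gt0P; exists e; rewrite !inE eqxx eF.
  by rewrite eq1; clear; lia.
have [x xS xu] := free_color c (dF' (al e) (predU1l _ (erefl _))).
have [|y yS yw] := @free_color c F' (be e) S; first by apply: dF'; rewrite /joins eqxx orbT.
set u := al e in xu; set w := be e in yw.
have xu' e' : e' \in F' -> jn e' u -> c e' != x.
  by move=> e'F ju; apply: contraNneq xu => <-; apply/colors_atP; exists e'.
have yw' e' : e' \in F' -> jn e' w -> c e' != y.
  by move=> e'F ju; apply: contraNneq yw => <-; apply/colors_atP; exists e'.
pose dir (a b : V) := if a \in A
  then [exists e' in F', [&& al e' == a, be e' == b & c e' == y]]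
  else [exists e' in F', [&& be e' == a, al e' == b & c e' == x]].
pose R := [set a | connect dir u a].
have uR : u \in R by rewrite inE connect0.
have Rstep a b : a \in R -> dir a b -> b \in R.
  by rewrite !inE => ua ab; apply: connect_trans ua (connect1 ab).
have Rpred b : b \in R -> u != b -> exists2 a, a \in R & dir a b.
  by rewrite inE => ub /(connect_last ub)[a ua ab]; exists a; rewrite ?inE.
have predB b : b \in R -> b \notin A ->
    exists e', [/\ e' \in F', al e' \in R, be e' = b & c e' = y].
  move=> bR bA; have [|a aR] := Rpred b bR; first by apply: contraNneq bA => <-; apply: alA.
  rewrite /dir; case: ifP => aA /exists_inP[e' e'F /and3P[/eqP a1 /eqP b1 /eqP c1]].
  - by exists e'; rewrite a1.
  - by move: bA; rewrite -b1 alA.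
have predA b : b \in R -> b \in A -> u != b ->
    exists e', [/\ e' \in F', be e' \in R, al e' = b & c e' = x].
  move=> bR bA ub; have [a aR] := Rpred b bR ub.
  rewrite /dir; case: ifP => aA /exists_inP[e' e'F /and3P[/eqP a1 /eqP b1 /eqP c1]].
  - by move: bA; rewrite -b1 (negbTE (beA _)).
  - by exists e'; rewrite a1.
have wR : w \notin R.
  apply/negP => /predB; case=> [|e' [e'F _ be' ce']]; first exact: beA.
  by move: (yw' e' e'F); rewrite /joins be' eqxx orbT ce' eqxx => /(_ isT).
have closed e' : e' \in F' -> (c e' == x) || (c e' == y) ->
    (al e' \in R) = (be e' \in R).
  move=> e'F /orP[/eqP cx|/eqP cy]; apply/idP/idP => h.
  - case: (eqVneq u (al e')) => [ue'|ue'].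
      by have := xu' e' e'F; rewrite /joins ue' eqxx cx eqxx => /(_ isT).
    have [e2 [e2F bR a2 c2]] := predA _ h (alA _) ue'.
    by rewrite -(cF' (al e') e2 e' e2F e'F _ _ (etrans c2 (esym cx))) // /joins ?a2 eqxx.
  - apply: (Rstep _ _ h); rewrite /dir (negbTE (beA _)); apply/exists_inP.
    by exists e' => //; rewrite cx !eqxx.
  - apply: (Rstep _ _ h); rewrite /dir alA; apply/exists_inP.
    by exists e' => //; rewrite cy !eqxx.
  - have [e2 [e2F aR b2 c2]] := predB _ h (beA _).
    by rewrite -(cF' (be e') e2 e' e2F e'F _ _ (etrans c2 (esym cy))) // /joins ?b2 eqxx orbT.
(* Testing the [A]-end suffices: by [closed] both ends of an edge coloured [x] or [y] agree on [R],
   and the transposition fixes all other colours. *)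
pose c1 e' := if al e' \in R then tperm x y (c e') else c e'.
have c1E e' v : e' \in F' -> jn e' v ->
    c1 e' = if v \in R then tperm x y (c e') else c e'.
  rewrite /c1 => e'F /orP[/eqP-> //|/eqP <-].
  case: (boolP ((c e' == x) || (c e' == y))) => [/(closed _ e'F)-> //|].
  by rewrite negb_or => /andP[? ?]; rewrite tpermD 1?eq_sym //; do 2!case: ifP.
have c1F' : proper_on F' c1.
  move=> v e1 e2 e1F e2F j1 j2; rewrite !(c1E _ v) //.
  by case: ifP => _ => [/perm_inj|]; apply: cF' j1 j2.
have c1y e' v : e' \in F' -> jn e' v -> jn e v -> c1 e' != y.
  move=> e'F j' /orP[/eqP uv|/eqP wv].
  - rewrite (c1E e' v) // -uv uR; apply/eqP => h.
    have := xu' e' e'F; rewrite /u uv j' => /(_ isT)/eqP; apply.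
    by apply: (@perm_inj _ (tperm x y)); rewrite h tpermL.
  - by rewrite (c1E e' v) // -wv (negbTE wR) yw' // /w wv.
exists (fun e' => if e' == e then y else c1 e').
- move=> v e1 e2 e1F e2F j1 j2.
  case: (eqVneq e1 e) => [e1e|n1]; case: (eqVneq e2 e) => [e2e|n2]; first by rewrite e1e e2e.
  + move=> h; have e2F' : e2 \in F' by rewrite !inE n2.
    by have := c1y e2 v e2F' j2; rewrite -h eqxx -e1e => /(_ j1).
  + move=> h; have e1F' : e1 \in F' by rewrite !inE n1.
    by have := c1y e1 v e1F' j1; rewrite h eqxx -e2e => /(_ j2).
  + by apply: c1F' j1 j2; rewrite !inE ?n1 ?n2.
- move=> e' e'F; case: (eqVneq e' e) => // n1.
  have e'F' : e' \in F' by rewrite !inE n1.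
  rewrite /c1; case: ifP => _; last exact: cS.
  by case: tpermP => // _ _; apply: cS.
Qed.

Definition matching (M : {set E}) : Prop :=
  forall v e e', e \in M -> e' \in M -> jn e v -> jn e' v -> e = e'.

(** Colouring [F :\: M] from [S :\ k] leaves [k] for [M] alone. This allows a single colour class to
    be designed by hand. *)
Lemma konig_class (F M : {set E}) (S : {set K}) k :
  k \in S -> M \subset F -> matching M -> (forall v, deg (F :\: M) v < #|S|) ->
  exists c, [/\ proper_on F c, forall e, e \in F -> c e \in S &
    forall e, e \in F -> (c e == k) = (e \in M)].
Proof.
move=> kS MF mM dS.
have [|c cF cS] := @konig (F :\: M) (S :\ k).
  by move=> v; have := dS v; rewrite (cardsD1 k) kS ltnS.
have ck e : e \in F -> e \notin M -> [/\ e \in F :\: M, c e != k & c e \in S].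
  by move=> eF eM; have /cS : e \in F :\: M; rewrite !inE eM // => /andP[].
exists (fun e => if e \in M then k else c e); split.
- move=> v e1 e2 e1F e2F j1 j2.
  case: ifP => [h1|/negbT h1]; case: ifP => [h2|/negbT h2].
  + by move=> _; apply: mM j1 j2.
  + by have [_ /eqP h _] := ck e2 e2F h2 => /esym.
  + by have [_ /eqP h _] := ck e1 e1F h1.
  + by have [? _ _] := ck e1 e1F h1; have [? _ _] := ck e2 e2F h2; apply: cF j1 j2.
- by move=> e eF; case: ifP => // /negbT /(ck e eF)[].
- by move=> e eF; case: ifP => [_|/negbT /(ck e eF)[_ /negbTE]]; rewrite ?eqxx.
Qed.

End BipartiteColoring.

Arguments jn_al {V E al be A} beA e {v}.
Arguments jn_be {V E al be A} alA e {v}.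

(** * Total colourings from two edge classes *)

Section TotalColoring.
Variables (V E K : finType) (al be : E -> V) (A : {set V}) (k0 : K).
Hypotheses (alA : forall e, al e \in A) (beA : forall e, be e \notin A).
Hypothesis simple : forall e e', al e = al e' -> be e = be e' -> e = e'.

Notation jn := (joins al be).
Notation deg := (sdeg al be).
Notation proper := (@proper_on V E K al be).
Notation colors := (@colors_at V E K al be).

(** The adjacent-distinguishing total colouring sought, stated for an edge subset so that the
    induction can delete edges without changing types. *)
Definition good (F : {set E}) : Prop :=
  exists (c : E -> K) (phi : V -> K),
  [/\ proper F c, forall e, e \in F -> phi (al e) != phi (be e),
      forall e, e \in F -> c e != phi (al e) /\ c e != phi (be e) &
      forall e, e \in F -> colors c F (al e) != colors c F (be e)].

Definition glue (H : {set E}) (c1 c2 : E -> K) (e : E) : K :=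
  if e \in H then c1 e else c2 e.

Lemma colors_at_full c (F : {set E}) v (S : {set K}) : proper F c ->
  (forall e, e \in F -> c e \in S) -> #|S| <= deg F v -> colors c F v = S.
Proof.
move=> cF cS le; apply/eqP; rewrite eqEcard (card_colors_at _ cF) le andbT.
by apply/subsetP => k /colors_atP[e [eF _ ->]]; apply: cS.
Qed.

Section Glue.
Variables (F H : {set E}) (S T : {set K}) (c1 c2 : E -> K).
Hypotheses (HF : H \subset F) (ST : [disjoint S & T]).
Hypotheses (c1H : proper H c1) (c1S : forall e, e \in H -> c1 e \in S).
Hypotheses (c2H : proper (F :\: H) c2) (c2T : forall e, e \in F :\: H -> c2 e \in T).

Let c := glue H c1 c2.

Let cE e : e \in F -> e \notin H -> e \in F :\: H.
Proof. by move=> eF eH; rewrite inE eH. Qed.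

Lemma glue_proper : proper F c.
Proof.
move=> v e1 e2 e1F e2F j1 j2; rewrite /c /glue.
case: ifP => [h1|/negbT/(cE e1F) h1]; case: ifP => [h2|/negbT/(cE e2F) h2].
- by apply: c1H j1 j2.
- by move=> h; have := disjointFr ST (c1S h1); rewrite h c2T.
- by move=> h; have := disjointFr ST (c1S h2); rewrite -h c2T.
- by apply: c2H j1 j2.
Qed.

Lemma glue_colors1 v : colors c F v :&: S = colors c1 H v.
Proof.
apply/setP => k; rewrite inE; apply/andP/colors_atP.
- case=> /colors_atP[e [eF ev ->]]; rewrite /c /glue.
  case: ifP => [eH _|/negbT/(cE eF) eH kS]; first by exists e.
  by have := disjointFr ST kS; rewrite c2T.
- case=> e [eH ev ->]; split; last exact: c1S.
  by apply/colors_atP; exists e; rewrite /c /glue eH (subsetP HF).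
Qed.

Lemma glue_colors2 v : colors c F v :&: T = colors c2 (F :\: H) v.
Proof.
apply/setP => k; rewrite inE; apply/andP/colors_atP.
- case=> /colors_atP[e [eF ev ->]]; rewrite /c /glue.
  case: ifP => [eH|/negbT/(cE eF) eH kS]; last by exists e.
  by rewrite (disjointFr ST) ?c1S.
- case=> e [eH ev ->]; split; last exact: c2T.
  apply/colors_atP; exists e; move: eH; rewrite /c /glue inE => /andP[/negbTE-> ->].
  by split.
Qed.

(** Vertices of [A] take a missing colour of [S], the others a missing colour of [T]; disjointness
    of [S] and [T] separates adjacent vertices. *)
Lemma good_glue :
  (forall v, v \in A -> deg H v < #|S|) ->
  (forall v, v \notin A -> deg (F :\: H) v < #|T|) ->
  (forall e, e \in F -> colors c F (al e) != colors c F (be e)) -> good F.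
Proof.
move=> dS dT dist.
pose phi v := odflt k0 [pick k in (if v \in A then S else T) :\: colors c F v].
have phiP v : (phi v \in if v \in A then S else T) && (phi v \notin colors c F v).
  rewrite /phi; case: pickP => [k|no] /=; first by rewrite inE andbC.
  exfalso; case: (boolP (v \in A)) no => vA no.
  - have [k kS] := free_color c1 (dS v vA).
    by rewrite -glue_colors1 inE kS andbT => kc; have := no k; rewrite inE kS kc.
  - have [k kT] := free_color c2 (dT v vA).
    by rewrite -glue_colors2 inE kT andbT => kc; have := no k; rewrite inE kT kc.
exists c, phi; split=> //.
- exact: glue_proper.
- move=> e eF; have /andP[] := phiP (al e); have /andP[] := phiP (be e).
  rewrite alA (negbTE (beA e)) => bT _ aS _; apply: contraTneq bT => <-.
  by rewrite (disjointFr ST aS).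
- move=> e eF; have /andP[_ h1] := phiP (al e); have /andP[_ h2] := phiP (be e).
  split; [apply: contraNneq h1 => <-|apply: contraNneq h2 => <-];
    apply/colors_atP; exists e; by rewrite /joins eqxx ?orbT.
Qed.

End Glue.

(* A colour class [tau] of [H'] is arranged to meet [A] only in vertices saturated
   by [H'], and in one end [a0] of an edge at [b0]; if need be a class of [H] is
   then arranged to meet [a0] but not [b0]. *)
Lemma distinguish_vertex (H H' : {set E}) (S T : {set K}) b0 :
  [disjoint H & H'] -> b0 \notin A ->
  (forall v, v \in A -> deg H v < #|S| /\ deg H' v <= #|T|) ->
  (forall v, v \notin A -> deg H v <= #|S| /\ deg H' v < #|T|) ->
  0 < deg H b0 < #|S| -> 0 < deg H' b0 ->
  exists c1 c2 : E -> K,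
  [/\ proper H c1 /\ (forall e, e \in H -> c1 e \in S),
      proper H' c2 /\ (forall e, e \in H' -> c2 e \in T) &
      forall a, a \in A -> colors c1 H a = colors c1 H b0 ->
        colors c2 H' a <> colors c2 H' b0].
Proof.
move=> HH' b0A dA dB /andP[hb0 hb0S] h'b0.
have dS v : deg H v <= #|S|.
  by case: (boolP (v \in A)) => [/dA[/ltnW]|/dB[]].
have dT v : deg H' v <= #|T|.
  by case: (boolP (v \in A)) => [/dA[]|/dB[_ /ltnW]].
have h'b0T : deg H' b0 < #|T| by case: (dB b0 b0A).
have [c1 c1H c1S] := konig k0 alA beA dS.
have [c2 c2H c2T] := konig k0 alA beA dT.
pose full := [set v | deg H' v == #|T|].
have fullA v : v \in full -> v \in A.
  rewrite inE => /eqP h; apply/negPn/negP => /dB[_].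
  by rewrite h ltnn.
have degD1 (X M : {set E}) v e : M \subset X -> e \in M -> jn e v ->
    deg (X :\: M) v < deg X v.
  move=> MX eM ev; rewrite (sdegD al be v MX) -[X in X < _]add0n ltn_add2r.
  by apply/card_gt0P; exists e; rewrite inE eM.
have fewer (M : {set E}) : M \subset H' ->
    (forall v, v \in full -> exists2 e, e \in M & jn e v) ->
    forall v, deg (H' :\: M) v < #|T|.
  move=> MH cov v; case: (boolP (v \in full)) => [vf|].
  - by have [e eM ev] := cov v vf; apply: leq_trans (dT v); apply: degD1 ev.
  - rewrite inE => vf; apply: leq_ltn_trans (sdegS _ _ _ (subsetDl _ _)) _.
    by rewrite ltn_neqAle vf dT.
have has tau v : tau \in T -> v \in full -> exists e, [/\ e \in H', jn e v & tau = c2 e].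
  move=> tT; rewrite inE => /eqP vf; apply/colors_atP.
  by rewrite (colors_at_full c2H c2T) ?vf.
case: (boolP [exists e in H', (be e == b0) && (al e \in full)]).
  case/exists_inP => e0 e0H /andP[/eqP e0b e0f].
  (* The class [tau] is cut down to its edges at saturated vertices, [e0] included. Then [b0] sees
     [tau], and every vertex of [A] that sees it has more [H']-colours than [b0]. *)
  pose tau := c2 e0; have tT : tau \in T by apply: c2T.
  pose M := [set e in H' | (c2 e == tau) && (al e \in full)].
  have MH : M \subset H' by apply/subsetP => e; rewrite inE => /andP[].
  have mM : matching al be M.
    move=> v e e'; rewrite !inE => /and3P[eH /eqP ce _] /and3P[e'H /eqP ce' _] j j'.
    by apply: (c2H v) => //; rewrite ce ce'.
  have [|c [cH cT cM]] := konig_class k0 alA beA tT MH mM.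
    apply: fewer => // v vf; have [e [eH ev ce]] := has tau v tT vf.
    exists e => //; rewrite inE eH -ce eqxx /=.
    by move: ev; rewrite (jn_al beA) ?fullA // => /eqP->.
  exists c1, c; split=> // a aA _ eq2.
  have : tau \in colors c H' b0.
    apply/colors_atP; exists e0; rewrite e0H /joins e0b eqxx orbT; split=> //.
    by apply/esym/eqP; rewrite cM // inE e0H eqxx e0f.
  rewrite -eq2 => /colors_atP[e [eH ea /esym/eqP]]; rewrite cM // inE => /and3P[_ _].
  move: ea; rewrite (jn_al beA) // => /eqP->; rewrite inE => /eqP fa.
  by have := h'b0T; rewrite -(card_colors_at b0 cH) -eq2 (card_colors_at a cH) fa ltnn.
rewrite negb_exists_in => /forall_inP noF.
have /card_gt0P[e0] := h'b0; rewrite inE => /andP[e0H].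
rewrite (jn_be alA) // => e0b; have e0f := noF e0 e0H; rewrite e0b /= in e0f.
set a0 := al e0 in e0f.
have [tau tT tb] := free_color c2 h'b0T.
(* No [H']-neighbour of [b0] is saturated here, and [tau] is missing at [b0], so [e0] can join the
   class. Among the ends in [A] of this class, only [a0] is unsaturated and can still share the
   [H']-colours of [b0]. *)
pose M := e0 |: [set e in H' | (c2 e == tau) && (al e \in full)].
have MH : M \subset H'.
  by rewrite subUset sub1set e0H; apply/subsetP => e; rewrite inE => /andP[].
have me0 v e : e \in H' -> c2 e = tau -> al e \in full -> jn e0 v -> jn e v -> False.
  move=> eH ce ef /orP[/eqP<-|].
  - by rewrite (jn_al beA) ?alA // => /eqP ea; move: e0f; rewrite /a0 -ea ef.
  - rewrite (eqP e0b) => /eqP <- ev; case/negP: tb; apply/colors_atP.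
    by exists e; split=> //; rewrite ce.
have mM : matching al be M.
  move=> v e e'; rewrite !inE => /predU1P[->|/and3P[eH /eqP ce fe]] /predU1P[->|/and3P[e'H /eqP ce' fe']] j j' //.
  - by exfalso; apply: (me0 v e') => //; rewrite inE.
  - by exfalso; apply: (me0 v e) => //; rewrite inE.
  - by apply: (c2H v) => //; rewrite ce ce'.
have [|c [cH cT cM]] := konig_class k0 alA beA tT MH mM.
  apply: fewer => // v vf; have [e [eH ev ce]] := has tau v tT vf.
  exists e => //; rewrite !inE eH -ce eqxx /= orbC.
  by move: ev; rewrite (jn_al beA) ?fullA // => /eqP->; move: vf; rewrite inE => ->.
have only a : a \in A -> colors c H' a = colors c H' b0 -> a = a0.
  move=> aA eq2.
  have : tau \in colors c H' b0.
    apply/colors_atP; exists e0; rewrite e0H /joins e0b orbT; split=> //.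
    by apply/esym/eqP; rewrite cM // !inE eqxx.
  rewrite -eq2 => /colors_atP[e [eH + /esym/eqP]]; rewrite cM // (jn_al beA) // => /eqP ea.
  rewrite !inE => /predU1P[ee|/and3P[_ _ /eqP]]; first by rewrite -ea ee.
  rewrite ea => fa.
  by have := h'b0T; rewrite -(card_colors_at b0 cH) -eq2 (card_colors_at a cH) fa ltnn.
have a0A : a0 \in A := alA e0.
case: (boolP (colors c1 H a0 == colors c1 H b0)) => [/eqP eq1|ne]; last first.
  exists c1, c; split=> // a aA eq1 eq2.
  by move: ne; rewrite -(only a aA eq2) eq1 eqxx.
have [sg sS sb] := free_color c1 hb0S.
have /card_gt0P[f] : 0 < deg H a0.
  by rewrite -(card_colors_at a0 c1H) eq1 (card_colors_at b0 c1H).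
rewrite inE => /andP[fH]; rewrite (jn_al beA) // => /eqP fa.
have fb : be f != b0.
  apply: contraTneq fH => fb; rewrite (_ : f = e0); first by rewrite (disjointFl HH').
  by apply: simple; rewrite ?fa ?fb ?(eqP e0b).
(* The colour [sg] is missing at [b0], hence at [a0], so [f] can join its class once a competing
   edge at [be f] is dropped. Afterwards [a0] sees [sg], but [b0] does not: it is not saturated by
   [H], and it is not an end of [f]. *)
pose M2 := f |: [set e in H | [&& c1 e == sg, deg H (be e) == #|S| & be e != be f]].
have M2H : M2 \subset H.
  by rewrite subUset sub1set fH; apply/subsetP => e; rewrite inE => /andP[].
have mf v e : e \in H -> c1 e = sg -> be e != be f -> jn f v -> jn e v -> False.
  move=> eH ce ef /orP[|/eqP<-].
  - rewrite fa => /eqP<- ev; case/negP: sb; rewrite -eq1; apply/colors_atP.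
    by exists e; split=> //; rewrite ce.
  - by rewrite (jn_be alA) ?beA // (negbTE ef).
have mM2 : matching al be M2.
  move=> v e e'; rewrite !inE => /predU1P[->|/and4P[eH /eqP ce _ fe]] /predU1P[->|/and4P[e'H /eqP ce' _ fe']] j j' //.
  - by exfalso; apply: (mf v e').
  - by exfalso; apply: (mf v e).
  - by apply: (c1H v) => //; rewrite ce ce'.
have [|d [dH dSS dM]] := konig_class k0 alA beA sS M2H mM2.
  move=> v; case: (boolP (deg H v == #|S|)) => [/eqP vf|vf]; last first.
    apply: leq_ltn_trans (sdegS _ _ _ (subsetDl _ _)) _.
    by rewrite ltn_neqAle vf dS.
  have vA : v \notin A by apply/negP => /dA[]; rewrite vf ltnn.
  rewrite -vf; case: (eqVneq (be f) v) => [fv|fv].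
    by apply: (degD1 _ _ _ f) => //; rewrite ?inE ?eqxx // (jn_be alA) // fv.
  have /colors_atP[e [eH ev ce]] : sg \in colors c1 H v.
    by rewrite (colors_at_full c1H c1S) ?vf.
  apply: (degD1 _ _ _ e) => //; move: ev; rewrite (jn_be alA) // => /eqP ev.
  by rewrite !inE eH -ce ev vf !eqxx [v == _]eq_sym fv orbT.
exists d, c; split=> // a aA eq3 eq2.
have : sg \in colors d H a.
  rewrite (only a aA eq2); apply/colors_atP; exists f; rewrite (jn_al beA) // fa eqxx.
  by split=> //; apply/esym/eqP; rewrite dM // !inE eqxx.
rewrite eq3 => /colors_atP[e [eH + /esym/eqP]]; rewrite dM // (jn_be alA) // => /eqP eb.
rewrite !inE => /predU1P[ef|/and4P[_ _ + _]]; first by rewrite -ef eb eqxx in fb.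
by rewrite eb => /eqP hS; rewrite hS ltnn in hb0S.
Qed.

End TotalColoring.

Arguments glue_colors1 {V E K} al be {F H S T c1 c2} HF ST c1S c2T v.
Arguments glue_colors2 {V E K} al be {F H S T c1 c2} ST c1S c2T v.

(** * Merging along a cut with at most one edge *)

(** Start from any permutation sending [p2] to [p1] and correct it by transpositions fixing [p1].
    The bound [1 < #|P1|] supplies a second colour [y] of [P1] to move, and the upper bound a colour
    outside [P1] other than the image of [f2]. *)
Lemma separating_perm (K : finType) (P1 P2 : {set K}) p1 p2 f1 f2 :
  p1 \in P1 -> f1 \notin P1 -> f2 \notin P2 ->
  1 < #|P1| -> #|P1| + 1 < #|K| ->
  exists pi : {perm K}, [/\ pi p2 = p1, pi f2 != f1 & pi @: P2 != P1].
Proof.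
move=> p1P f1P f2P lt1 ltK.
have /card_gt0P[y] : 0 < #|P1 :\ p1| by move: lt1; rewrite (cardsD1 p1) p1P.
rewrite !inE => /andP[yp1 yP].
have neP (a b : K) : a \in P1 -> b \notin P1 -> b != a.
  by move=> aP; apply: contraNneq => ->.
have [pi [pip pif]] : exists pi : {perm K}, pi p2 = p1 /\ pi f2 != f1.
  pose pi := tperm p1 p2.
  have pip : pi p2 = p1 by rewrite tpermR.
  case: (eqVneq (pi f2) f1) => [pf|]; last by exists pi.
  exists (pi * tperm f1 y)%g; rewrite !permM pip pf tpermL; split.
    by rewrite tpermD // neP.
  by rewrite eq_sym neP.
case: (eqVneq (pi @: P2) P1) => [piP|]; last by exists pi.
have wP : pi f2 \notin P1.
  by rewrite -piP mem_imset //; apply: perm_inj.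
have /card_gt0P[z] : 0 < #|~: (pi f2 |: P1)|.
  by have := cardsC (pi f2 |: P1); rewrite cardsU1 wP; move: ltK; clear; lia.
rewrite !inE negb_or => /andP[zw zP].
exists (pi * tperm y z)%g; rewrite !permM pip; split.
- by rewrite tpermD // neP.
- by rewrite tpermD // ?[y == _]eq_sym neP.
apply/negP => /eqP eP; have : y \in [set (pi * tperm y z)%g x | x in P2] by rewrite eP.
case/imsetP => x xP; rewrite permM => /(congr1 (tperm y z)); rewrite tpermK tpermL => zx.
by case/negP: zP; rewrite -piP zx mem_imset //; apply: perm_inj.
Qed.

Section Merge.
Variables (V E K : finType) (al be : E -> V).

Notation jn := (joins al be).
Notation deg := (sdeg al be).
Notation colors := (@colors_at V E K al be).

Definition touching (F : {set E}) (Z : {set V}) : {set E} :=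
  [set e in F | (al e \in Z) || (be e \in Z)].

Lemma sdeg_touching (F : {set E}) (Z : {set V}) v :
  v \in Z -> deg (touching F Z) v = deg F v.
Proof.
move=> vZ; apply: eq_card => e; rewrite !inE /joins.
by case: eqP => [->|_]; case: eqP => [->|_]; rewrite ?vZ ?orbT ?andbT ?andbF.
Qed.

(** A crossing edge is coloured on both sides. Permuting the colours of the far side makes its two
    colours agree while its ends keep distinct colours and distinct palettes. *)
Lemma good_merge (F : {set E}) (Z : {set V}) :
  (forall v, deg F v + 2 < #|K|) -> #|cut al be F Z| <= 1 ->
  (forall e v, e \in cut al be F Z -> jn e v -> 1 < deg F v) ->
  @good V E K al be (touching F Z) -> @good V E K al be (touching F (~: Z)) ->
  @good V E K al be F.
Proof.
move=> dK cut1 cutC [c1 [phi1 [pr1 ad1 in1 di1]]] [c2 [phi2 [pr2 ad2 in2 di2]]].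
set F1 := touching F Z in pr1 ad1 in1 di1; set F2 := touching F (~: Z) in pr2 ad2 in2 di2.
have inF1 e v : e \in F -> jn e v -> v \in Z -> e \in F1.
  by move=> eF /orP[] /eqP<- vZ; rewrite inE eF vZ ?orbT.
have inF2 e v : e \in F -> jn e v -> v \notin Z -> e \in F2.
  by move=> eF /orP[] /eqP<- vZ; rewrite inE eF !inE vZ ?orbT.
have F1F e : e \in F1 -> e \in F by rewrite inE => /andP[].
have F2F e : e \in F2 -> e \in F by rewrite inE => /andP[].
have not1 e v : e \in F1 -> jn e v -> phi1 v != c1 e.
  by move=> eF /orP[] /eqP<-; have [] := in1 e eF; rewrite eq_sym // => _; rewrite eq_sym.
have not2 e v : e \in F2 -> jn e v -> phi2 v != c2 e.
  by move=> eF /orP[] /eqP<-; have [] := in2 e eF; rewrite eq_sym // => _; rewrite eq_sym.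
(* Only a crossing edge constrains [pi]; if there is none, the identity will do. *)
have [pi pic] : exists pi : {perm K}, forall e u w, e \in F -> jn e u -> jn e w ->
    u \in Z -> w \notin Z ->
    [/\ pi (c2 e) = c1 e, pi (phi2 w) != phi1 u & pi @: colors c2 F2 w != colors c1 F1 u].
  have inX e u w : e \in F -> jn e u -> jn e w -> u \in Z -> w \notin Z ->
      e \in cut al be F Z.
    rewrite inE => -> /orP[] /eqP<- /orP[] /eqP<-;
      by case: (al e \in Z); case: (be e \in Z).
  case: (set_0Vmem (cut al be F Z)) => [X0|[e0 e0X]].
    by exists 1%g => e u w eF eu ew uZ wZ; have := inX e u w eF eu ew uZ wZ; rewrite X0 inE.
  have only e u w : e \in F -> jn e u -> jn e w -> u \in Z -> w \notin Z -> e = e0.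
    move=> eF eu ew uZ wZ; have eX := inX e u w eF eu ew uZ wZ.
    by move: cut1 => /card_le1_eqP; apply.
  have [u [w [uZ wZ eu ew uw]]] : exists u w, [/\ u \in Z, w \notin Z, jn e0 u, jn e0 w &
      forall v, jn e0 v -> v = if v \in Z then u else w].
    move: (e0X); rewrite inE => /andP[_]; rewrite /joins.
    case: (boolP (al e0 \in Z)); case: (boolP (be e0 \in Z)) => // bZ aZ _.
    - exists (al e0), (be e0); rewrite !eqxx orbT; split=> // v /orP[] /eqP<-.
        by rewrite aZ.
      by rewrite (negbTE bZ).
    - exists (be e0), (al e0); rewrite !eqxx orbT; split=> // v /orP[] /eqP<-.
        by rewrite (negbTE aZ).
      by rewrite bZ.
  have e0F : e0 \in F by move: e0X; rewrite inE => /andP[].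
  have e01 := inF1 e0 u e0F eu uZ; have e02 := inF2 e0 w e0F ew wZ.
  have cu : #|colors c1 F1 u| = deg F u by rewrite card_colors_at // sdeg_touching.
  have [||||| pi [h1 h2 h3]] := @separating_perm K (colors c1 F1 u) (colors c2 F2 w)
    (c1 e0) (c2 e0) (phi1 u) (phi2 w).
  - by apply/colors_atP; exists e0.
  - by apply/negP => /colors_atP[e [eF ev] /eqP]; apply/negP/not1.
  - by apply/negP => /colors_atP[e [eF ev] /eqP]; apply/negP/not2.
  - by rewrite cu; apply: cutC e0X eu.
  - by rewrite cu; have := dK u; clear; lia.
  exists pi => e u' w' eF eu' ew' uZ' wZ'; have ee := only e u' w' eF eu' ew' uZ' wZ'.
  rewrite ee in eu' ew' *.
  by rewrite (uw u' eu') (uw w' ew') uZ' (negbTE wZ').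
pose c e := if e \in F1 then c1 e else pi (c2 e).
pose phi v := if v \in Z then phi1 v else pi (phi2 v).
have cE2 e v : e \in F -> jn e v -> v \notin Z -> c e = pi (c2 e).
  move=> eF ev vZ; rewrite /c; case: ifP => //; rewrite inE eF /=.
  case/orP => h; [have [] := pic e (al e) v eF|have [] := pic e (be e) v eF] => //;
    by rewrite /joins eqxx ?orbT.
have cE1 e v : e \in F -> jn e v -> v \in Z -> c e = c1 e.
  by move=> eF ev vZ; rewrite /c (inF1 e v).
have col1 v : v \in Z -> colors c F v = colors c1 F1 v.
  move=> vZ; apply/setP => k; apply/colors_atP/colors_atP => -[e [eF ev ->]]; exists e.
  - by split; rewrite ?(inF1 e v) // (cE1 e v).
  - by split; rewrite ?F1F // (cE1 e v) // F1F.
have col2 v : v \notin Z -> colors c F v = pi @: colors c2 F2 v.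
  move=> vZ; apply/setP => k; apply/colors_atP/imsetP => [[e [eF ev ->]]|[k2 /colors_atP[e [eF ev ->]] ->]].
  - exists (c2 e); last by rewrite (cE2 e v).
    by apply/colors_atP; exists e; rewrite ?(inF2 e v).
  - by exists e; rewrite F2F // (cE2 e v) ?F2F.
exists c, phi; split.
- move=> v e e' eF e'F ev e'v; case: (boolP (v \in Z)) => vZ.
    by rewrite !(cE1 _ v) //; apply: (pr1 v) => //; apply: (inF1 _ v).
  by rewrite !(cE2 _ v) // => /perm_inj; apply: (pr2 v) => //; apply: (inF2 _ v).
all: move=> e eF; have ja : jn e (al e) by rewrite /joins eqxx.
all: have jb : jn e (be e) by rewrite /joins eqxx orbT.
- rewrite /phi; case: (boolP (al e \in Z)) => aZ; case: (boolP (be e \in Z)) => bZ.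
  + by apply: ad1; apply: inF1 ja aZ.
  + by rewrite eq_sym; have [] := pic e (al e) (be e) eF.
  + by have [] := pic e (be e) (al e) eF.
  + by rewrite (inj_eq perm_inj); apply: ad2; apply: inF2 ja aZ.
- suff cphi v : jn e v -> c e != phi v by split; apply: cphi.
  move=> ev; rewrite /phi eq_sym; case: ifP => [vZ|/negbT vZ].
  + by rewrite (cE1 e v) // not1 // (inF1 e v).
  + by rewrite (cE2 e v) // (inj_eq perm_inj) not2 // (inF2 e v).
- case: (boolP (al e \in Z)) => aZ; case: (boolP (be e \in Z)) => bZ.
  + by rewrite !col1 //; apply: di1; apply: inF1 ja aZ.
  + by rewrite col1 // col2 // eq_sym; have [] := pic e (al e) (be e) eF.
  + by rewrite col2 // [colors c F (be e)]col1 //; have [] := pic e (be e) (al e) eF.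
  + by rewrite !col2 // (inj_eq (imset_inj perm_inj)); apply: di2; apply: inF2 ja aZ.
Qed.

End Merge.

(** * Graphs whose core is 2-edge-connected *)

(** Parity of [h] fixes [2h - d] modulo 4, which makes one of the two bounds strict. The palette
    sizes [(uphalf D).+1] and [D./2.+2] add up to [D + 3]. *)
Lemma window_in (D d h : nat) : 2 * h <= d + 3 -> d <= 2 * h + 3 -> h <= d <= D ->
  odd h = odd (uphalf d) -> h < (uphalf D).+1 /\ d - h <= D./2.+2.
Proof. lia. Qed.

Lemma window_out (D d h : nat) : 2 * h <= d + 3 -> d <= 2 * h + 3 -> h <= d <= D ->
  odd h = ~~ odd (uphalf d) -> h <= (uphalf D).+1 /\ d - h < D./2.+2.
Proof. lia. Qed.

(** Outside [A] this is the wrong parity; with the sharper root bound it forces an even split,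
    rounded up. *)
Lemma window_root (d h : nat) : 2 * h <= d + 2 -> d <= 2 * h + 2 ->
  odd h = odd (uphalf d) -> h = uphalf d.
Proof. lia. Qed.

Lemma ex_set_card (T : finType) n : n <= #|T| -> exists S : {set T}, #|S| = n.
Proof.
move=> le; exists [set x in take n (enum T)].
rewrite cardsE (card_uniqP _) ?take_uniq ?enum_uniq // size_takel //.
by rewrite -cardE.
Qed.

Section Direct.
Variables (V E K : finType) (al be : E -> V) (A : {set V}) (D : nat).
Hypotheses (alA : forall e, al e \in A) (beA : forall e, be e \notin A).
Hypothesis simple : forall e e', al e = al e' -> be e = be e' -> e = e'.
Hypothesis cardK : #|K| = D + 3.

Notation jn := (joins al be).
Notation deg := (sdeg al be).
Notation colors := (@colors_at V E K al be).

Definition branching (F : {set E}) : {set V} := [set v | 1 < deg F v].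

Section FixF.
Variable F : {set E}.
Hypothesis dF : forall v, deg F v <= D.
Hypothesis D2 : 1 < D.
Notation C := (branching F).
Hypothesis noiso : forall e, e \in F -> (al e \in C) || (be e \in C).

(* With [|2 h - d| <= 3], this leaves [2 h - d] in [{0}] or [{1, -3}] on [A], and in
   [{2, -2}] or [{-1, 3}] outside [A], according to the parity of [d]. *)
Definition right_parity (H : {set E}) (v : V) : bool :=
  odd (deg H v) == odd (uphalf (deg F v)) (+) (v \notin A).

Definition balanced_at (k : nat) (H : {set E}) (v : V) : Prop :=
  2 * deg H v <= deg F v + k /\ deg F v <= 2 * deg H v + k.

Let k0 : K.
Proof. by apply: (@enum_val _ predT); rewrite cardK addn3; apply: ord0. Qed.

(** Vertices outside [C] have degree at most 1 and fit because [1 < D]; the others fit by the window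
    lemmas. *)
Lemma window_at (S T : {set K}) (H : {set E}) v : H \subset F ->
  #|S| = (uphalf D).+1 -> #|T| = D./2.+2 ->
  (v \in C -> right_parity H v /\ balanced_at 3 H v) ->
  if v \in A then deg H v < #|S| /\ deg (F :\: H) v <= #|T|
  else deg H v <= #|S| /\ deg (F :\: H) v < #|T|.
Proof.
move=> HF -> ->; have := sdegD al be v HF; have := dF v.
rewrite /right_parity inE; move: (deg (F :\: H) v) => h' dv eqd.
have -> : h' = deg F v - deg H v by rewrite eqd addKn.
have le : deg H v <= deg F v <= D by rewrite dv eqd leq_addr.
case: (leqP (deg F v) 1) => [d1 _|d2 /(_ isT)[/eqP]].
  by case: ifP => _; move: d1 D2 le; clear; lia.
case: (v \in A) => /=; rewrite ?addbF ?addbT => par [b1 b2].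
- exact: window_in.
- exact: window_out.
Qed.

(** Equal palettes give both ends the same degree in [H] and in [F]. Hence neither end is a leaf,
    and the opposite parities prescribed on the two sides clash. *)
Lemma parity_conflict (c : E -> K) (S T : {set K}) (c1 c2 : E -> K) (H : {set E}) e :
  H \subset F -> [disjoint S & T] ->
  proper_on al be H c1 -> (forall e, e \in H -> c1 e \in S) ->
  proper_on al be (F :\: H) c2 -> (forall e, e \in F :\: H -> c2 e \in T) ->
  e \in F -> (al e \in C -> right_parity H (al e)) ->
  (be e \in C -> right_parity H (be e)) ->
  colors (glue H c1 c2) F (al e) != colors (glue H c1 c2) F (be e).
Proof.
move=> HF ST p1 i1 p2 i2 eF ra rb; apply/negP => /eqP eqc.
have := glue_colors1 al be HF ST i1 i2 (al e); rewrite eqc (glue_colors1 al be HF ST i1 i2) => eq1.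
have := glue_colors2 al be ST i1 i2 (al e); rewrite eqc (glue_colors2 al be ST i1 i2) => eq2.
have h1 : deg H (be e) = deg H (al e) by rewrite -!(card_colors_at _ p1) eq1.
have h2 : deg (F :\: H) (be e) = deg (F :\: H) (al e) by rewrite -!(card_colors_at _ p2) eq2.
have h3 : deg F (be e) = deg F (al e) by rewrite !(sdegD _ _ _ HF) h1 h2.
have CC : (be e \in C) = (al e \in C) by rewrite !inE h3.
have aC : al e \in C by have := noiso eF; rewrite CC orbb.
move: (ra aC) (rb (etrans CC aC)); rewrite /right_parity h1 h3 alA beA /= addbF addbT.
by move=> /eqP->; case: odd.
Qed.

Lemma color_classes : exists S T : {set K},
  [/\ [disjoint S & T], #|S| = (uphalf D).+1 & #|T| = D./2.+2].
Proof.
have [|S cS] := @ex_set_card K (uphalf D).+1.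
  by rewrite cardK; clear; lia.
exists S, (~: S); rewrite disjoints_subset setCK; split=> //.
by have := cardsC S; rewrite cardK cS; clear; lia.
Qed.

Lemma good_all_right (H : {set E}) : H \subset F ->
  (forall v, v \in C -> right_parity H v /\ balanced_at 3 H v) -> good K al be F.
Proof.
move=> HF hyp; have [S [T [ST cS cT]]] := color_classes.
have win v := window_at HF cS cT (hyp v).
have [|c1 p1 i1] := @konig _ _ _ _ _ _ k0 alA beA H S.
  by move=> v; have := win v; case: ifP => _ [] // /ltnW.
have [|c2 p2 i2] := @konig _ _ _ _ _ _ k0 alA beA (F :\: H) T.
  by move=> v; have := win v; case: ifP => _ [] // _ /ltnW.
apply: (good_glue k0 alA beA HF ST p1 i1 p2 i2).
- by move=> v vA; have := win v; rewrite vA => -[].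
- by move=> v vA; have := win v; rewrite (negbTE vA) => -[].
- move=> e eF; apply: parity_conflict ST p1 i1 p2 i2 eF _ _ => //; by move=> /hyp[].
Qed.

(** By [window_root] the edges at [b0] are split evenly, so both classes are present and unsaturated
    there, as [distinguish_vertex] requires. Edges away from [b0] are settled by parity. *)
Lemma good_one_wrong (H : {set E}) b0 : H \subset F -> b0 \notin A -> b0 \in C ->
  (forall v, v \in C -> v != b0 -> right_parity H v /\ balanced_at 3 H v) ->
  ~~ right_parity H b0 -> balanced_at 2 H b0 -> good K al be F.
Proof.
move=> HF b0A b0C hyp wrong [b1 b2]; have [S [T [ST cS cT]]] := color_classes.
have hb0 : deg H b0 = uphalf (deg F b0).
  apply: window_root => //; move: wrong; rewrite /right_parity b0A addbT.
  by case: odd; case: odd.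
have h'b0 : deg (F :\: H) b0 = (deg F b0)./2.
  by have := sdegD al be b0 HF; rewrite hb0; clear; lia.
have db0 : 1 < deg F b0 by rewrite inE in b0C.
have win v : if v \in A then deg H v < #|S| /\ deg (F :\: H) v <= #|T|
    else deg H v <= #|S| /\ deg (F :\: H) v < #|T|.
  case: (eqVneq v b0) => [->|vb]; last by apply: window_at => // vC; apply: hyp.
  by rewrite (negbTE b0A) cS cT hb0 h'b0; have := dF b0; clear; lia.
have [||||||c1 [c2 [[p1 i1] [p2 i2] di]]] :=
  @distinguish_vertex V E K al be A k0 alA beA simple H (F :\: H) S T b0.
- by rewrite -setI_eq0; apply/eqP/setP => e; rewrite !inE; case: (e \in H); rewrite ?andbF.
- by [].
- by move=> v vA; have := win v; rewrite vA.
- by move=> v vA; have := win v; rewrite (negbTE vA).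
- by rewrite cS hb0; have := dF b0; move: db0; clear; lia.
- by rewrite h'b0; move: db0; clear; lia.
apply: (good_glue k0 alA beA HF ST p1 i1 p2 i2).
- by move=> v vA; have := win v; rewrite vA => -[].
- by move=> v vA; have := win v; rewrite (negbTE vA) => -[].
move=> e eF; case: (eqVneq (be e) b0) => [eb|eb].
  apply/negP => /eqP eqc; rewrite eb in eqc.
  apply: (di (al e) (alA e)).
  - by rewrite -!(glue_colors1 al be HF ST i1 i2) eqc.
  - by rewrite -!(glue_colors2 al be ST i1 i2) eqc.
apply: parity_conflict ST p1 i1 p2 i2 eF _ _ => // vC; last by case: (hyp _ vC eb).
by case: (hyp _ vC) => //; apply: contraNneq b0A => <-.
Qed.

(** * Case analysis on the number of leaf edges *)

Definition core : {set E} := [set e in F | (al e \in C) && (be e \in C)].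

Hypothesis core_conn : edge_connected al be 2 C core.
Hypothesis F0 : F != set0.

Let coreF : core \subset F.
Proof. by apply/subsetP => e; rewrite inE => /andP[]. Qed.

Let neq_ends e : al e != be e.
Proof. by apply: contraTneq (alA e) => ->; apply: beA. Qed.

Let core_edges : edges_on al be C core.
Proof. by move=> e; rewrite inE => /and3P[]; split. Qed.

Let target v := odd (uphalf (deg F v)) (+) (v \notin A).

(* All leaves are identified to the single root [None], which has no constraint. *)
Lemma good_many_leaves : 1 < #|F :\: core| -> good K al be F.
Proof.
move=> leaves.
pose mu v := if v \in C then Some v else None.
pose s e := mu (al e); pose t e := mu (be e).
have jS e v : v \in C -> joins s t e (Some v) = jn e v.
  move=> vC; rewrite /joins /s /t /mu.
  by congr orb; case: ifP => h; rewrite ?(inj_eq Some_inj) //; apply/esym/negbTE;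
    apply: contraFneq h => ->.
have dS (X : {set E}) v : v \in C -> sdeg s t X (Some v) = deg X v.
  by move=> vC; apply: eq_card => e; rewrite inE jS // inE.
have := @balanced_join _ _ s t (split_vertices C) F None
  (fun w => if w is Some v then target v else true).
case=> [|e eF|Z ZC|X [XF par bnd _]].
- by rewrite inE.
- rewrite !inE /s /t /mu; have := noiso eF; have := neq_ends e.
  by case: ifP => aC; case: ifP => bC //=; rewrite ?aC ?bC.
- pose Z0 := [set v | Some v \in Z].
  have cutE e : e \in core -> ((s e \in Z) != (t e \in Z)) = ((al e \in Z0) != (be e \in Z0)).
    by rewrite inE /s /t /mu => /and3P[_ -> ->]; rewrite !inE.
  case: (boolP (splits C Z0)) => [/core_conn|nsp].
    move=> h; apply: (leq_trans h); apply/subset_leq_card/subsetP => e.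
    by rewrite [e \in _]inE => /andP[ec]; rewrite -cutE // inE (subsetP coreF).
  (* Here [C] lies on one side of [Z] and [None] on the other, so every leaf edge crosses, and there
     are at least two. *)
  apply: (leq_trans leaves); apply/subset_leq_card/subsetP => e.
  case/setDP=> eF nc; rewrite inE eF /s /t /mu /=; move: nc (noiso eF).
  have Z0E v : (v \in Z0) = (Some v \in Z) by rewrite inE.
  have side v : v \in C -> (Some v \in Z) != (None \in Z).
    move=> vC; case/andP: ZC => /set0Pn[w /setIP[wC wZ]] /set0Pn[w' /setDP[w'C w'Z]].
    move: nsp; rewrite negb_and !negbK => /orP[]/eqP/setP h.
    - have vZ : Some v \notin Z by have := h v; rewrite in_setI vC Z0E in_set0 /= => ->.
      case: w wC wZ => [u|_ ->]; last by rewrite (negbTE vZ).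
      by rewrite in_set => uC uZ; have := h u; rewrite in_setI uC Z0E uZ in_set0.
    - have vZ : Some v \in Z by have := h v; rewrite in_setD vC Z0E in_set0 andbT => /negbFE.
      case: w' w'C w'Z => [u|_ /negbTE->]; last by rewrite vZ.
      by rewrite in_set => uC uZ; have := h u; rewrite in_setD uC Z0E uZ in_set0.
  rewrite [e \in core]in_set eF.
  case: (boolP (al e \in C)) => aC; case: (boolP (be e \in C)) => bC //= _ _.
  + exact: side.
  + by rewrite eq_sym; apply: side.
apply: (good_all_right XF) => v vC; have vC' : Some v \in split_vertices C by rewrite inE.
have [b1 b2] := bnd _ vC'; rewrite !dS // in b1 b2.
by split=> //; rewrite /right_parity -(dS X) // par.
Qed.

(* The leaf edge is put in or out of [H] so as to repair the parity at its other
   end, which is the root. *)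
Lemma good_one_leaf e0 : F :\: core = [set e0] -> good K al be F.
Proof.
move=> Le.
have e0L : e0 \in F :\: core by rewrite Le set11.
have e0F : e0 \in F by case/setDP: e0L.
have [r rC [er only]] : exists2 r, r \in C & jn e0 r /\ forall v, v \in C -> v != r -> ~~ jn e0 v.
  have := noiso e0F; have : e0 \notin core by case/setDP: e0L.
  rewrite inE e0F /joins /=.
  case: (boolP (al e0 \in C)) => aC; case: (boolP (be e0 \in C)) => bC //= _ _.
  - exists (al e0); rewrite ?eqxx //; split=> // v vC.
    rewrite eq_sym => /negbTE-> /=; by apply: contraNneq bC => ->.
  - exists (be e0); rewrite ?eqxx ?orbT //; split=> // v vC.
    rewrite eq_sym => /negbTE->; rewrite orbF; by apply: contraNneq aC => ->.
have dcore v : deg F v = deg core v + jn e0 v.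
  by rewrite (sdegD _ _ v coreF) Le sdeg1.
have [X [Xc par bnd [r1 r2]]] := balanced_join target rC core_edges core_conn.
have e0X : e0 \notin X by apply/negP => /(subsetP Xc) h; case/setDP: e0L => _; rewrite h.
have XF := subset_trans Xc coreF.
(* The flag [b] records whether [e0] is put into [H]. Either way [2h - d] at [r] changes by one, so
   the root bound 2 in the core becomes the bound 3 in [F]. *)
have go (H : {set E}) (b : bool) : H \subset F -> (forall v, deg H v = deg X v + b * jn e0 v) ->
    right_parity H r -> good K al be F.
  move=> HF dH rH; apply: (good_all_right HF) => v vC; rewrite /balanced_at.
  case: (eqVneq v r) => [->|vr].
    by split=> //; rewrite dcore dH er; move: r1 r2; clear; case: b; lia.
  have := par v vC vr; have := bnd v vC; rewrite /right_parity dH dcore (negbTE (only v vC vr)).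
  rewrite muln0 !addn0 => bv pv; split=> //; apply/eqP; rewrite pv /target.
  by rewrite dcore (negbTE (only v vC vr)) addn0.
have dX' v : deg (e0 |: X) v = deg X v + true * jn e0 v.
  rewrite (sdegD _ _ v (subsetUr [set e0] X)) mul1n -sdeg1; congr addn; congr sdeg.
  by apply/setP => e; rewrite !inE; case: eqP => [->|]; rewrite ?(negbTE e0X) ?andbT //= andNb.
case: (boolP (right_parity X r)) => rX.
  by apply: (go X false XF) => // v; rewrite mul0n addn0.
apply: (go (e0 |: X) true) => //; first by rewrite subUset sub1set e0F.
move: rX; rewrite /right_parity dX' er oddD /=.
by case: odd; case: odd; case: (r \in A).
Qed.

(** The root is taken outside [A], since [good_one_wrong] repairs a wrong parity only there. *)
Lemma good_no_leaf : F :\: core = set0 -> good K al be F.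
Proof.
move=> L0; have FE : core = F.
  by apply/eqP; rewrite eqEsubset coreF -setD_eq0 L0 eqxx.
have [e0 e0F] := set0Pn _ F0.
have e0c : e0 \in core by rewrite FE.
have bC : be e0 \in C by move: e0c; rewrite inE => /and3P[].
have cE := core_edges; have cc := core_conn; rewrite FE in cE cc.
have [X [XF par bnd bnd0]] := balanced_join target bC cE cc.
have hyp v : v \in C -> v != be e0 -> right_parity X v /\ balanced_at 3 X v.
  by move=> vC vb; split; [rewrite /right_parity par|apply: bnd].
case: (boolP (right_parity X (be e0))) => wb.
- apply: (good_all_right XF) => v vC; case: (eqVneq v (be e0)) => [->|]; last exact: hyp.
  by split=> //; apply: bnd.
- exact: (good_one_wrong XF (beA e0) bC hyp wb bnd0).
Qed.

Lemma good_core : good K al be F.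
Proof.
case: (ltnP 1 #|F :\: core|) => [|le]; first exact: good_many_leaves.
case: (set_0Vmem (F :\: core)) => [|[e eL]]; first exact: good_no_leaf.
apply: (@good_one_leaf e); apply/eqP; rewrite eq_sym eqEcard sub1set eL cards1.
exact: le.
Qed.

End FixF.

End Direct.

(** * Induction on the number of edges *)

Section Induction.
Variables (V E K : finType) (al be : E -> V) (A : {set V}) (D : nat).
Hypotheses (alA : forall e, al e \in A) (beA : forall e, be e \notin A).
Hypothesis simple : forall e e', al e = al e' -> be e = be e' -> e = e'.
Hypothesis cardK : #|K| = D + 3.

Notation jn := (joins al be).
Notation deg := (sdeg al be).
Notation C F := (branching al be F).

(* Leaves are put on the side of their neighbour, so that only core edges cross. *)
Definition with_leaves (F : {set E}) (Z : {set V}) : {set V} :=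
  [set v | if v \in C F then v \in Z else
    [exists e in F, jn e v && ((al e \in C F :&: Z) || (be e \in C F :&: Z))]].

(** This turns a small cut of the core into an equally small cut of [F], as [good_merge]
    requires. *)
Lemma cut_with_leaves (F : {set E}) (Z : {set V}) :
  (forall e, e \in F -> (al e \in C F) || (be e \in C F)) ->
  cut al be F (with_leaves F Z) = cut al be (core al be F) Z.
Proof.
move=> noiso.
have inC v : v \in C F -> (v \in with_leaves F Z) = (v \in Z).
  by move=> vC; rewrite in_set vC.
have leaf e v w : e \in F -> jn e v -> jn e w -> v \notin C F -> w \in C F ->
    (v \in with_leaves F Z) = (w \in with_leaves F Z).
  move=> eF ev ew vC wC; rewrite (inC w wC) in_set (negbTE vC).
  have vw : v != w by apply: contraNneq vC => ->.
  have ends u : (u \in C F :&: Z) && jn e u = [&& u == w, u \in Z & jn e u].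
    rewrite in_setI; case: (eqVneq u w) => [->|uw] /=; first by rewrite wC ew.
    apply/negP => /andP[/andP[uC _] eu].
    have uv : u != v by apply: contraNneq vC => <-.
    move: ev ew eu uv uw vw; rewrite /joins.
    case: (eqVneq (al e) v) => [<- _|_ /eqP<-]; case: (eqVneq _ w) => [<- _|_ /eqP<-];
      by rewrite ?eqxx //; case: (eqVneq _ u) => [<-|_ /eqP<-]; rewrite ?eqxx.
  have -> : (w \in Z) = (al e \in C F :&: Z) || (be e \in C F :&: Z).
    have ha := ends (al e); have hb := ends (be e).
    have ja : jn e (al e) by rewrite /joins eqxx.
    have jb : jn e (be e) by rewrite /joins eqxx orbT.
    rewrite ja !andbT in ha; rewrite jb !andbT in hb.
    rewrite ha hb; move: ew; rewrite /joins => /orP[]/eqP<-; rewrite eqxx /=.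
    + by case: (eqVneq (be e) (al e)) => [->|] /=; rewrite ?orbb ?orbF.
    + by case: (eqVneq (al e) (be e)) => [->|] /=; rewrite ?orbb.
  apply/exists_inP/idP => [[e' e'F /andP[e'v h]]|h]; last by exists e; rewrite ?ev.
  suff <- : e' = e by [].
  move: vC; rewrite in_set -leqNgt => /card_le1_eqP; apply; by rewrite inE ?eF ?e'F.
apply/setP => e; rewrite [LHS]in_set [RHS]in_set [e \in core _ _ _]in_set.
case eF: (e \in F) => //=.
have ja : jn e (al e) by rewrite /joins eqxx.
have jb : jn e (be e) by rewrite /joins eqxx orbT.
case: (boolP (al e \in C F)) => aC; case: (boolP (be e \in C F)) => bC /=.
- by rewrite !inC.
- by rewrite (leaf e (be e) (al e)) // eqxx.
- by rewrite (leaf e (al e) (be e)) // eqxx.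
- by have := noiso e eF; rewrite (negbTE aC) (negbTE bC).
Qed.

(** Of the two or more edges at [u] at most one crosses, so another avoids [W] altogether. *)
Lemma touching_small (F : {set E}) (W : {set V}) u :
  u \notin W -> 1 < deg F u -> #|cut al be F W| <= 1 -> #|touching al be F W| < #|F|.
Proof.
move=> uW du cW; apply: proper_card; apply/properP; split.
  by apply/subsetP => e; rewrite inE => /andP[].
suff /subsetPn[e] : ~~ ([set e in F | jn e u] \subset cut al be F W).
  rewrite !inE => /andP[eF eu]; rewrite eF /= negbK => /eqP eqW.
  exists e => //; rewrite inE eF eqW orbb /=.
  by move: eu uW => /orP[]/eqP<-; rewrite ?eqW.
by apply/negP => /subset_leq_card/leq_trans/(_ cW); rewrite leqNgt du.
Qed.

(** Vertices of [W] keep all their edges. An edge inside [W] thus keeps its branching end, and a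
    crossing edge has branching ends on both sides. *)
Lemma touching_noiso (F : {set E}) (W : {set V}) :
  (forall e, e \in F -> (al e \in C F) || (be e \in C F)) ->
  (forall e v, e \in cut al be F W -> jn e v -> 1 < deg F v) ->
  forall e, e \in touching al be F W ->
    (al e \in C (touching al be F W)) || (be e \in C (touching al be F W)).
Proof.
move=> noiso cC e; rewrite inE => /andP[eF tW].
have inC v : v \in W -> (v \in C (touching al be F W)) = (v \in C F).
  by move=> vW; rewrite !inE sdeg_touching.
case: (boolP (e \in cut al be F W)) => [ec|].
  have ca : al e \in C F by rewrite inE; apply: cC ec _; rewrite /joins eqxx.
  have cb : be e \in C F by rewrite inE; apply: cC ec _; rewrite /joins eqxx orbT.
  by case/orP: tW => /inC->; rewrite ?ca ?cb ?orbT.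
rewrite inE eF negbK => /eqP eqW; rewrite eqW orbb in tW.
by rewrite !inC ?eqW //; apply: noiso.
Qed.

(** Induction on the number of edges with [D] and [K] fixed, so that both sides of a small cut use
    the same [D + 3] colours. If there is no small cut of the core, [good_core] applies. *)
Lemma good_all (F : {set E}) : (forall v, deg F v <= D) ->
  (forall e, e \in F -> (al e \in C F) || (be e \in C F)) -> good K al be F.
Proof.
have [n] := ubnP #|F|; elim: n F => // n IH F ltn dF noiso.
have /card_gt0P[k0 _] : 0 < #|K| by rewrite cardK addn3.
case: (set_0Vmem F) => [F0|[e0 e0F]].
  by exists (fun=> k0), (fun=> k0); split=> [v e e'|e|e|e]; rewrite F0 inE.
have D2 : 1 < D.
  by case/orP: (noiso e0 e0F); rewrite inE => /leq_trans; apply.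
case: (boolP [forall Z, splits (C F) Z ==> (1 < #|cut al be (core al be F) Z|)]).
  move=> /forallP conn; apply: (good_core alA beA simple cardK dF D2 noiso).
  - by move=> Z; apply/implyP.
  - by apply/set0Pn; exists e0.
case/forallPn => Z0; rewrite negb_imply -leqNgt => /andP[/andP[/set0Pn[u uZ] /set0Pn[w wZ]] cut1].
pose Z := with_leaves F Z0; rewrite -(cut_with_leaves _ noiso) -/Z in cut1.
have [uC uZ0] := setIP uZ; have [wC wZ0] := setDP wZ.
have uZ' : u \in Z by rewrite in_set uC.
have wZ' : w \notin Z by rewrite in_set wC.
have du : 1 < deg F u by rewrite in_set in uC.
have dw : 1 < deg F w by rewrite in_set in wC.
have cutT : cut al be F (~: Z) = cut al be F Z.
  apply/setP => e; rewrite [LHS]in_set [RHS]in_set !in_setC.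
  by case: (al e \in Z); case: (be e \in Z).
have cC e v : e \in cut al be F Z -> jn e v -> 1 < deg F v.
  rewrite cut_with_leaves // in_set [e \in core _ _ _]in_set => /andP[/and3P[_ aC bC] _].
  by rewrite in_set in aC; rewrite in_set in bC => /orP[]/eqP<-.
have sub (W : {set V}) v : deg (touching al be F W) v <= deg F v.
  by apply/sdegS/subsetP => e; rewrite inE => /andP[].
apply: (good_merge (Z := Z)) => //.
- by move=> v; have := dF v; rewrite cardK; clear; lia.
- apply: IH.
  + exact: leq_trans (touching_small wZ' dw cut1) ltn.
  + by move=> v; apply: leq_trans (dF v).
  + exact: touching_noiso.
- apply: IH.
  + have uZn : u \notin ~: Z by rewrite in_setC uZ'.
    by apply: leq_trans (touching_small uZn du _) ltn; rewrite cutT.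
  + by move=> v; apply: leq_trans (dF v).
  + by apply: touching_noiso; rewrite ?cutT.
Qed.

End Induction.

(** * The theorem *)

Section BipartiteGraph.
Variables (G : sgraph) (A : {set G}).
Hypothesis bipA : forall u v : G, adj u v -> (u \in A) != (v \in A).

Lemma edge_ends (e : edge G) :
  exists u v : G, [/\ u \in A, v \notin A, adj u v & val e = [set u; v]].
Proof.
case/existsP: (valP e) => u /existsP[v /andP[uv /eqP ee]]; have := bipA uv.
case: (boolP (u \in A)) => uA; case: (boolP (v \in A)) => vA // _.
- by exists u, v.
- by exists v, u; rewrite adj_sym setUC.
Qed.

Lemma ex_end_in (e : edge G) : exists u, u \in val e :&: A.
Proof. by have [u [v [uA _ _ ->]]] := edge_ends e; exists u; rewrite !inE eqxx. Qed.

Lemma ex_end_out (e : edge G) : exists v, v \in val e :\: A.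
Proof. by have [u [v [_ vA _ ->]]] := edge_ends e; exists v; rewrite !inE vA eqxx orbT. Qed.

(** Choosing the end on each side of the bipartition turns unordered edges into the end maps [al]
    and [be] used above. *)
Definition end_in (e : edge G) : G := xchoose (ex_end_in e).
Definition end_out (e : edge G) : G := xchoose (ex_end_out e).

Lemma end_inA e : end_in e \in A.
Proof. by case/setIP: (xchooseP (ex_end_in e)). Qed.

Lemma end_outA e : end_out e \notin A.
Proof. by case/setDP: (xchooseP (ex_end_out e)). Qed.

Lemma edgeE e : val e = [set end_in e; end_out e] /\ adj (end_in e) (end_out e).
Proof.
have [u [v [uA vA uv ee]]] := edge_ends e.
have -> : end_in e = u.
  have /setIP[] := xchooseP (ex_end_in e); rewrite -/(end_in e) ee => /set2P[] // ->.
  by rewrite (negbTE vA).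
have -> : end_out e = v.
  have /setDP[] := xchooseP (ex_end_out e); rewrite -/(end_out e) ee => /set2P[] // ->.
  by rewrite uA.
by [].
Qed.

Notation jn := (joins end_in end_out).

Lemma joinsE e v : jn e v = (v \in val e).
Proof. by have [-> _] := edgeE e; rewrite !inE /joins ![v == _]eq_sym. Qed.

Lemma edge_simple e e' : end_in e = end_in e' -> end_out e = end_out e' -> e = e'.
Proof.
by move=> h1 h2; apply: val_inj; have [-> _] := edgeE e; have [-> _] := edgeE e'; rewrite h1 h2.
Qed.

Lemma adj_edge (u v : G) : adj u v -> exists e : edge G, val e = [set u; v].
Proof.
move=> uv; have h : is_edge [set u; v].
  by apply/existsP; exists u; apply/existsP; exists v; rewrite uv eqxx.
by exists (Sub [set u; v] h).
Qed.

Lemma adj_ends (u v : G) : adj u v -> exists e,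
  (u = end_in e /\ v = end_out e) \/ (u = end_out e /\ v = end_in e).
Proof.
move=> uv; have [e ee] := adj_edge uv; exists e.
have uv' : u != v by apply: contraTneq uv => ->; rewrite adj_irrefl.
have [eI _] := edgeE e.
have /set2P[h1|h1] : u \in [set end_in e; end_out e] by rewrite -eI ee set21.
- left; split=> //; have /set2P[h2|//] : v \in [set end_in e; end_out e] by rewrite -eI ee set22.
  by rewrite h1 h2 eqxx in uv'.
- right; split=> //; have /set2P[//|h2] : v \in [set end_in e; end_out e] by rewrite -eI ee set22.
  by rewrite h1 h2 eqxx in uv'.
Qed.

(** Sending an incident edge to its other end is a bijection onto the neighbours of [u], the graph
    being simple. *)
Lemma card_inc (u : G) : #|inc u| = deg u.
Proof.
pose o := other_end end_in end_out u.
have oE e : e \in inc u -> val e = [set u; o e] /\ adj u (o e).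
  rewrite inE -joinsE /joins /o /other_end; have [-> h] := edgeE e.
  by case: eqP h => [-> //|_] h /= /eqP <-; rewrite setUC adj_sym.
rewrite /deg -(card_in_imset (f := o)) => [|e e' ei e'i eo].
- apply: eq_card => w; rewrite inE; apply/imsetP/idP => [[e ei ->]|uw].
    by have [] := oE e ei.
  have [e ee] := adj_edge uw; have ei : e \in inc u by rewrite inE ee set21.
  exists e => //; have [eo uo] := oE e ei.
  have : w \in [set u; o e] by rewrite -eo ee set22.
  by case/set2P => // wu; rewrite wu adj_irrefl in uw.
- by apply: val_inj; have [-> _] := oE e ei; have [-> _] := oE e' e'i; rewrite eo.
Qed.

Lemma deg_max (u : G) : deg u <= max_deg G.
Proof. exact: (leq_bigmax u). Qed.

Lemma sdeg_edges v : sdeg end_in end_out setT v = deg v.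
Proof. by rewrite -card_inc; apply: eq_card => e; rewrite !inE joinsE. Qed.

Lemma edges_branch : (forall e : edge G, ~~ isolated_edge e) -> forall e : edge G,
  (end_in e \in branching end_in end_out setT) || (end_out e \in branching end_in end_out setT).
Proof.
move=> noiso e; have /forallPn[e'] := noiso e.
rewrite negb_imply negbK => /andP[e'e /set0Pn[x /setIP[xe xe']]].
have : x \in branching end_in end_out setT.
  rewrite in_set ltnNge; apply/negP => /card_le1_eqP/(_ e' e).
  by rewrite !inE !joinsE xe xe' => /(_ isT isT) h; rewrite h eqxx in e'e.
by move: xe; rewrite -joinsE => /orP[]/eqP-> ->; rewrite ?orbT.
Qed.

Lemma as_total_of_good : good 'I_(max_deg G + 3) end_in end_out setT ->
  as_total_colorable G (max_deg G + 3).
Proof.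
case=> c [phi [pr ad ce di]].
apply/existsP; exists [ffun x => match x with inl u => phi u | inr e => c e end].
have pal u : palette (fun E => [ffun x => match x with inl u => phi u | inr e => c e end] (inr E)) u
    = colors_at end_in end_out c setT u.
  apply/setP => k; apply/imsetP/colors_atP => [[e ei ->]|[e [_ ei ->]]].
  - by exists e; rewrite ffunE joinsE; rewrite inE in ei.
  - by exists e; rewrite ?ffunE // inE -joinsE.
apply/andP; split; last first.
  apply/forallP => u; apply/forallP => v; apply/implyP => /adj_ends[e h]; rewrite !pal.
  by case: h => -[-> ->]; [|rewrite eq_sym]; apply: di.
apply/and3P; split.
- apply/forallP => u; apply/forallP => v; apply/implyP => /adj_ends[e h]; rewrite !ffunE.
  by case: h => -[-> ->]; [|rewrite eq_sym]; apply: ad.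
- apply/forallP => e; apply/forallP => e'; apply/implyP => /andP[ee' /set0Pn[x /setIP[xe xe']]].
  rewrite !ffunE; apply: contra ee' => /eqP h; apply/eqP.
  by apply: (pr x) => //; rewrite joinsE.
- apply/forallP => u; apply/forall_inP => e; rewrite inE -joinsE !ffunE.
  by move=> /orP[]/eqP<-; case: (ce e).
Qed.

Lemma s_total_of_extension k m (g : edge G -> 'I_k) (phi : G -> 'I_(k + m)) :
  proper_edge_coloring g -> vertex_distinguishing g ->
  (forall u v, adj u v -> phi u != phi v) ->
  (forall u e, e \in inc u -> lshift m (g e) != phi u) -> s_total_colorable G (k + m).
Proof.
move=> gP gD ad ce.
apply/existsP; exists [ffun x => match x with inl u => phi u | inr e => lshift m (g e) end].
set f := finfun _.
have pal u : palette (fun e => f (inr e)) u = lshift m @: palette g u.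
  by rewrite -imset_comp; apply: eq_imset => e; rewrite /f ffunE.
apply/andP; split; last first.
  apply/forallP => u; apply/forallP => v; apply/implyP => uv; rewrite !pal.
  rewrite (inj_eq (imset_inj (@lshift_inj _ _))).
  by move/forallP: gD => /(_ u)/forallP/(_ v)/implyP; apply.
apply/and3P; split.
- by apply/forallP => u; apply/forallP => v; apply/implyP => uv; rewrite !ffunE ad.
- apply/forallP => e; apply/forallP => e'; apply/implyP => h; rewrite !ffunE.
  rewrite (inj_eq (@lshift_inj _ _)).
  by move/forallP: gP => /(_ e)/forallP/(_ e')/implyP; apply.
- by apply/forallP => u; apply/forall_inP => e eu; rewrite !ffunE ce.
Qed.

Lemma s_total_two k : s_edge_colorable G k -> s_total_colorable G (k + 2).
Proof.
case/existsP => g /andP[gP gD].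
apply: (s_total_of_extension (phi := fun u => rshift k (inord (u \in A) : 'I_2)) gP gD).
- move=> u v /bipA; apply: contra; rewrite (inj_eq (@rshift_inj _ _)) => /eqP/(congr1 val).
  by rewrite /= !inordK //; do 2!case: (_ \in A).
- by move=> u e _; rewrite eq_lrshift.
Qed.

(** At most [max_deg G] of the [k] old colours occur at a vertex, so each vertex outside [A] can
    take a missing old colour, which differs from the new colour given to all of [A]. *)
Lemma s_total_one k : max_deg G < k -> s_edge_colorable G k -> s_total_colorable G (k + 1).
Proof.
move=> lt /existsP[g /andP[gP gD]].
have free u : exists i, i \notin palette g u.
  have : 0 < #|~: palette g u|.
    have h1 := cardsC (palette g u); rewrite card_ord in h1.
    have h2 : #|palette g u| <= max_deg G.
      by apply: leq_trans (leq_imset_card g (inc u)) _; rewrite card_inc deg_max.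
    by move: lt h1 h2; clear; lia.
  by case/card_gt0P => i; rewrite inE; exists i.
pose phi u := if u \in A then rshift k (ord0 : 'I_1) else lshift 1 (xchoose (free u)).
apply: (s_total_of_extension (phi := phi) gP gD) => [u v /bipA|u e eu]; rewrite /phi.
- by case: ifP; case: ifP => // _ _ _; rewrite ?eq_lrshift ?eq_rlshift.
- case: ifP => _; rewrite ?eq_lrshift //.
  rewrite (inj_eq (@lshift_inj _ _)); apply: contraNneq (xchooseP (free u)) => <-.
  exact: imset_f.
Qed.

End BipartiteGraph.

Theorem theorem6 (n : nat) (G : sgraph) (hG : F3s n G) (hB : bipartite G) :
  chi_as'' hG <= max_deg G + 3 /\
  chi_s'' hG <= chi_s' hG + (if max_deg G < chi_s' hG then 1 else 2).
Proof.
have [A bipA] := hB; split.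
- rewrite /chi_as''; case: ex_minnP => m _; apply.
  apply: (as_total_of_good (bipA := bipA)); apply: (good_all (A := A) (D := max_deg G)).
  + exact: end_inA.
  + exact: end_outA.
  + exact: edge_simple.
  + exact: card_ord.
  + by move=> v; rewrite sdeg_edges deg_max.
  + by move=> e _; apply: edges_branch; case: hG.
- rewrite /chi_s''; case: ex_minnP => m _; apply.
  rewrite /chi_s'; case: ex_minnP => k kP _; case: ifP => h.
  + exact: (s_total_one bipA).
  + exact: (s_total_two bipA).
Qed.
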